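(* Let $K=\mathbb F_q$ be a finite field with $q$ elements. Consider the conjugation action of $G=\mathrm O_2(K)=\{\sigma\in\mathrm{GL}_2(K):\sigma^{-1}=\sigma^{\mathrm{tr}}\}$ on $T=K[a,b,d]$, the polynomial ring on the entries of the symmetric matrix $\begin{pmatrix} a & b \\ b & d \end{pmatrix}$. Then $T^G$ is a polynomial ring given as $$T^G=K[\mathrm{trace},\ \det,\ f_3],$$ where $\mathrm{trace}=a+d$, $\det=ad-b^2$, and $f_3$ is chosen as follows. (i) If $q$ is odd, then $f_3=N(a)$; we have $\deg(f_3)=|G|/4$ and $a(T^G)=-\left(3+\tfrac12\left(q-(-1)^{(q-1)/2}\right)\right)$. (ii) If $q=2^{e+1}$ with $e\ge0$, then $$f_3=\sum_{k=0}^e b^{2^k}(a+d)^{2^e-2^k};$$ we have $\deg(f_3)=|G|/2=q/2$ and $a(T^G)=-\left(3+\tfrac q2\right)$.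
   Context: The conjugation action: $\sigma\in G$ acts on $T$ by the $K$-algebra automorphism sending each variable to the corresponding entry of $\sigma^{-1}\begin{pmatrix} a & b \\ b & d \end{pmatrix}\sigma$ (which is again symmetric); equivalently $T=\mathrm{Sym}(W^* )$ with $W$ the space of symmetric $2\times2$ matrices over $K$, with $G$ acting on $W$ by $M\mapsto\sigma M\sigma^{-1}$. $N(a)$ denotes the orbit product of $a$, i.e. the product of all the (distinct) polynomials in the $G$-orbit of $a$; it is regarded as an element of $T$. $T$ has the standard grading. $a(T^G)$ is the $a$-invariant, which for a graded Cohen–Macaulay ring equals the degree (numerator degree minus denominator degree) of its Hilbert series. *)

(* Defs.v *)
From HB Require Import structures.
From mathcomp Require Import all_boot all_order all_algebra all_fingroup.
From mathcomp Require Export mpoly.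

Set Implicit Arguments.
Unset Strict Implicit.
Unset Printing Implicit Defensive.

Import Order.TTheory GRing.Theory Num.Theory.
Local Open Scope ring_scope.

Section GradedSubalgebras.
Variables (K : fieldType) (n : nat).
Implicit Types (R : {pred {mpoly K[n]}}) (p : {mpoly K[n]}).

Definition mpdeg p : nat := (msize p).-1.

Definition in_alg m (x : m.-tuple {mpoly K[n]}) p : Prop :=
  exists g : {mpoly K[m]}, p = g \mPo x.

Definition alg_indep m (x : m.-tuple {mpoly K[n]}) : Prop :=
  forall g : {mpoly K[m]}, g \mPo x = 0 -> g = 0.

Definition is_polynomial_ring_on R m (x : m.-tuple {mpoly K[n]}) : Prop :=
  (forall p, p \in R <-> in_alg x p) /\ alg_indep x.

Definition module_finite R m (x : m.-tuple {mpoly K[n]}) : Prop :=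
  exists N (w : N.-tuple {mpoly K[n]}),
    (forall j, tnth w j \in R) /\
    forall p, p \in R -> exists c : 'I_N -> {mpoly K[m]},
      p = \sum_(j < N) (c j \mPo x) * tnth w j.

(* For a finitely generated graded K-algebra R with R_0 = K, a homogeneous
   system of parameters is the same as a homogeneous Noether normalization;
   in particular m is then the Krull dimension of R. *)
Definition hsop R m (x : m.-tuple {mpoly K[n]}) (d : 'I_m -> nat) : Prop :=
  [/\ forall i, (0 < d i)%N,
      forall i, tnth x i \in R /\ tnth x i \is (d i).-homog,
      alg_indep x
    & module_finite R x].

(* The top local cohomology of R at its homogeneous maximal ideal is the
   cokernel of the last map of the Cech complex on x_1, .., x_m:
     R_{x_1 ... x_m} / \sum_i image of R_{x_1 .. (omit x_i) .. x_m}.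
   Clearing denominators, the class of r / (x_1 ... x_m)^k is zero iff
   r (x_1 ... x_m)^l lies in the ideal (x_1^(k+l), .., x_m^(k+l)) of R for
   some l. *)
Definition cech_class_zero R m (x : m.-tuple {mpoly K[n]}) (k : nat) p : Prop :=
  exists (l : nat) (s : 'I_m -> {mpoly K[n]}),
    (forall i, s i \in R) /\
    p * (\prod_(i < m) tnth x i) ^+ l
      = \sum_(i < m) s i * tnth x i ^+ (k + l).

Definition top_local_cohomology_neq0
    R m (x : m.-tuple {mpoly K[n]}) (d : 'I_m -> nat) (z : int) : Prop :=
  exists (k e : nat) p,
    [/\ p \in R, p \is e.-homog, z = e%:Z - (k * \sum_(i < m) d i)%N%:Z
      & ~ cech_class_zero R x k p].

(* The a-invariant is the largest degree in which the top local cohomology is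
   nonzero.  The local cohomology modules do not depend on the chosen system of
   parameters, so any one may be used to compute them. *)
Definition is_a_invariant R (z : int) : Prop :=
  exists m (x : m.-tuple {mpoly K[n]}) (d : 'I_m -> nat),
    [/\ hsop R x d,
        top_local_cohomology_neq0 R x d z
      & forall z', top_local_cohomology_neq0 R x d z' -> z' <= z].

End GradedSubalgebras.

Section OrthogonalConjugation.
Variable K : finFieldType.

Definition O2 : {set {'GL_2[K]}} :=
  [set s : {'GL_2[K]} | invmx (GLval s) == (GLval s)^T].

Lemma O2_group_set : group_set O2.
Proof.
apply/group_setP; split=> [|s t]; first by rewrite inE GL_1E invmx1 trmx1.
rewrite !inE => /eqP hs /eqP ht.
by rewrite -GL_VxE invMg GL_MxE !GL_VxE hs ht -trmx_mul.
Qed.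
Canonical O2_group := Group O2_group_set.

Local Notation T := {mpoly K[3]}.

Definition va : T := 'X_(@Ordinal 3 0 isT).
Definition vb : T := 'X_(@Ordinal 3 1 isT).
Definition vd : T := 'X_(@Ordinal 3 2 isT).

Definition symM : 'M[T]_2 :=
  \matrix_(i, j) (if i == j then (if i == 0 then va else vd) else vb).

Lemma tr_symM : \tr symM = va + vd.
Proof. by rewrite /mxtrace big_ord_recl big_ord1 !mxE. Qed.

Lemma det_symM : \det symM = va * vd - vb ^+ 2.
Proof. rewrite (expand_det_row _ 0) big_ord_recl big_ord1 /cofactor !det_mx11 !mxE /=.
by rewrite expr0 expr1 mul1r mulN1r mulrN expr2. Qed.

Definition conjM (s : {'GL_2[K]}) : 'M[T]_2 :=
  map_mx (@mpolyC 3 K) (invmx (GLval s)) *m symM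
    *m map_mx (@mpolyC 3 K) (GLval s).

Definition conj_act (s : {'GL_2[K]}) (p : T) : T :=
  p \mPo [tuple conjM s 0 0; conjM s 0 1; conjM s 1 1].

Definition invariants : {pred T} :=
  [pred p | [forall s in O2, conj_act s p == p]].

(* [undup] makes this the product over the distinct elements of the orbit. *)
Definition orbit_prod (p : T) : T :=
  \prod_(f <- undup [seq conj_act s p | s in O2]) f.

Definition f3_even (e : nat) : T :=
  \sum_(0 <= k < e.+1) vb ^+ (2 ^ k) * (va + vd) ^+ (2 ^ e - 2 ^ k).

End OrthogonalConjugation.

Arguments symM : clear implicits.
Arguments invariants : clear implicits.

(* Main.v *)
Require Import Defs.
From HB Require Import structures.
From mathcomp Require Import all_boot all_order all_algebra all_fingroup.
From mathcomp Require Import finfield ring.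
Import Order.TTheory GRing.Theory Num.Theory.
Local Open Scope ring_scope.
Set Implicit Arguments.
Unset Strict Implicit.
Unset Printing Implicit Defensive.

(** Let v be a in odd characteristic and b in characteristic 2, and let N(v) be
its orbit product. No other element of the orbit of v is proportional to v, so
an invariant divisible by v is divisible by all the pairwise coprime linear
forms of the orbit, hence by N(v). On the other hand the image of an invariant p
modulo v is the image of some r in K[trace, det]: in odd characteristic because
the reflection b -> -b fixes a, in characteristic 2 because the swap of a and d
fixes b. So p - r = N(v) h with h invariant of smaller degree, and induction
gives the generators. In characteristic 2, f_3 is an invariant divisible by b of
the same degree as N(b), hence a nonzero multiple of N(b). Algebraic
independence follows by killing one variable at a time. The degrees come from
counting the circle x^2 + y^2 = 1, which has q + 1 - #{u | u^2 = -1} points. For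
a polynomial ring on homogeneous generators of degrees d_i, the top local
cohomology is spanned by the monomials with negative exponents only, so the
a-invariant is minus the sum of the d_i. *)

(** * Substitution, coefficients and homogeneity of multivariate polynomials *)

Section MPolyComplements.
Variable K : fieldType.

Lemma comp_mpolyA n m k (x : n.-tuple {mpoly K[m]}) (y : m.-tuple {mpoly K[k]})
    (p : {mpoly K[n]}) :
  (p \mPo x) \mPo y = p \mPo [tuple tnth x i \mPo y | i < n].
Proof.
rewrite (comp_mpolyE p) [RHS]comp_mpolyE raddf_sum; apply: eq_bigr => mm _.
rewrite /= comp_mpolyZ rmorph_prod; congr (_ *: _); apply: eq_bigr => i _.
by rewrite rmorphXn tnth_mktuple.
Qed.

Lemma comp_mpoly_eq n m k (x : n.-tuple {mpoly K[m]})
    (y : m.-tuple {mpoly K[k]}) (z : n.-tuple {mpoly K[k]}) (p : {mpoly K[n]}) :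
  (forall i, tnth x i \mPo y = tnth z i) -> (p \mPo x) \mPo y = p \mPo z.
Proof.
move=> xy; rewrite comp_mpolyA; congr (_ \mPo _).
by apply: eq_from_tnth => i; rewrite tnth_mktuple xy.
Qed.

Lemma comp_mpolyXt n k (x : n.-tuple {mpoly K[k]}) i :
  'X_i \mPo x = tnth x i.
Proof. by rewrite comp_mpolyXU -tnth_nth. Qed.

Lemma mcoeffMX_eq0 n (p : {mpoly K[n]}) (m k : 'X_{1..n}) :
  ~~ (m <= k)%MM -> (p * 'X_[m])@_k = 0.
Proof.
move=> lemk; apply: memN_msupp_eq0; apply: contra lemk.
rewrite (perm_mem (msuppMX _ _)) => /mapP[m' _ ->].
exact: lem_addr.
Qed.

Lemma dhomog_bigprod n (I : Type) (r : seq I) (F : I -> {mpoly K[n]}) D :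
  (forall i, F i \is (D i).-homog) ->
  \prod_(i <- r) F i \is (\sum_(i <- r) D i)%N.-homog.
Proof.
move=> homF; elim/big_ind2: _ => // [|p d q e]; first exact: dhomog1.
exact: dhomogM.
Qed.

End MPolyComplements.

(** * The a-invariant of a polynomial ring *)

Section AInvariant.
Variables (K : fieldType) (n : nat) (R : {pred {mpoly K[n]}}).
Variables (m : nat) (x : m.-tuple {mpoly K[n]}) (d : 'I_m -> nat).
Hypothesis Rx : is_polynomial_ring_on R x.
Hypothesis d_gt0 : forall i, (0 < d i)%N.
Hypothesis homx : forall i, tnth x i \is (d i).-homog.

Lemma polynomial_ring_gen i : tnth x i \in R.
Proof. by apply/(proj1 Rx); exists 'X_i; rewrite comp_mpolyXt. Qed.

(** [R] is its own Noether normalization, so 1 alone generates it as a module. *)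
Lemma polynomial_ring_hsop : hsop R x d.
Proof.
split=> //; first by move=> i; split;
  [exact: polynomial_ring_gen | exact: homx].
  by case: Rx.
exists 1%N, [tuple 1]; split=> [j|p /(proj1 Rx)[g ->]].
  by apply/(proj1 Rx); exists 1; rewrite (ord1 j) rmorph1.
by exists (fun=> g); rewrite big_ord1 /= (tnth_nth 0) mulr1.
Qed.

(** The class of 1/(x_1...x_m) survives. A relation (x_1...x_m)^l = sum of s_i x_i^(l+1) would lift,
    by algebraic independence, to the abstract polynomial ring, where the monomial with all
    exponents l does not occur on the right. *)
Lemma polynomial_ring_top_neq0 :
  top_local_cohomology_neq0 R x d (- (\sum_(i < m) d i)%N%:Z).
Proof.
exists 1%N, 0%N, 1; split; rewrite ?dhomog1 ?mul1n ?add0r //.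
  by apply/(proj1 Rx); exists 1; rewrite rmorph1.
case=> l [s [sR]]; rewrite mul1r.
have [g Dg] : exists g, forall i, s i = g i \mPo x.
  by apply: (@fin_all_exists _ _ (fun i gi => s i = gi \mPo x)) => i;
    apply/(proj1 Rx).
pose u : 'X_{1..m} := [multinom l | i < m].
pose h : {mpoly K[m]} := 'X_[u] - \sum_(i < m) g i * 'X_[(U_(i) *+ l.+1)%MM].
move=> eq_s; have : h \mPo x = 0.
  rewrite /h comp_mpolyB comp_mpolyX rmorph_sum /=; apply/eqP; rewrite subr_eq0.
  rewrite (eq_bigr (fun i => tnth x i ^+ l)); last first.
    by move=> i _; rewrite mnmE.
  rewrite prodrXl eq_s; apply/eqP; apply: eq_bigr => i _.
  by rewrite rmorphM /= -Dg -mpolyXn rmorphXn /= comp_mpolyXt.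
move/(proj2 Rx)/(congr1 (mcoeff u)); rewrite mcoeffB mcoeffX eqxx raddf_sum /=.
rewrite big1 => [|i _]; first by rewrite mcoeff0 subr0 => /eqP;
  rewrite oner_eq0.
rewrite mcoeffMX_eq0 //; apply/negP=> /mnm_lepP/(_ i).
by rewrite mulmnE mnm1E eqxx mul1n mnmE ltnn.
Qed.

(** Pigeonhole: a monomial in the x_i of weighted degree e with all exponents at most k-1 would give
    e + sum d_i <= k sum d_i. So every monomial of [p] is divisible by some x_i^k, and the class
    vanishes already with l = 0. *)
Lemma polynomial_ring_cech_zero (k e : nat) (p : {mpoly K[n]}) :
  p \in R -> p \is e.-homog -> (k * \sum_(i < m) d i < e + \sum_(i < m) d
    i)%N ->
  cech_class_zero R x k p.
Proof.
move=> /(proj1 Rx)[g Dp] homp le_e.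
suff [s [sR ->]] : exists s : 'I_m -> {mpoly K[n]},
    (forall i, s i \in R) /\ p = \sum_(i < m) s i * tnth x i ^+ k.
  by exists 0%N, s; split=> //; rewrite expr0 mulr1 addn0.
pose wt (v : 'X_{1..m}) := (\sum_(i < m) d i * v i)%N.
have homX v : 'X_[v] \mPo x \is (wt v).-homog.
  by rewrite comp_mpolyX dhomog_bigprod // => i; apply: dhomogMn.
(* Taking the degree [e] part of both sides discards the monomials of [g] of any other weight. *)
have {Dp} -> : p = \sum_(v <- msupp g | wt v == e) g@_v *: ('X_[v] \mPo x).
  rewrite -(pihomog_dE homp) Dp comp_mpolyEX raddf_sum [RHS]big_mkcond /=.
  apply: eq_bigr => v _; rewrite linearZ /=.
  case: eqP => [<-|/eqP ne]; first by rewrite pihomog_dE.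
  by rewrite (pihomog_ne0 ne) ?scaler0.
elim/big_ind: _ => [|q r [s [sR ->]] [t [tR ->]]|v /eqP wtv].
- exists (fun=> 0); split=> [i|]; last by rewrite big1 // => i _; rewrite mul0r.
  by apply/(proj1 Rx); exists 0; rewrite rmorph0.
- exists (fun i => s i + t i); split=> [i|]; last first.
    by rewrite -big_split; apply: eq_bigr => i _; rewrite mulrDl.
  have /(proj1 Rx)[a ->] := sR i; have /(proj1 Rx)[b ->] := tR i.
  by apply/(proj1 Rx); exists (a + b); rewrite rmorphD.
have [/existsP[i le_kv]|] := boolP [exists i, k <= v i]%N; last first.
  rewrite negb_exists => /forallP lt_vk; move: le_e.
  rewrite ltnNge => /negP[]; rewrite -wtv -big_split big_distrr /=;
    apply: leq_sum => i _.
  by rewrite -mulnSr mulnC leq_mul2r ltnNge lt_vk orbT.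
exists (fun j => if j == i then (g@_v *: 'X_[v - U_(i) *+ k]) \mPo x else 0).
split=> [j|].
  apply/(proj1 Rx); case: eqP => _; first by eexists.
  by exists 0; rewrite rmorph0.
rewrite (bigD1 i) //= eqxx big1 => [|j /negPf->]; last by rewrite mul0r.
rewrite addr0 comp_mpolyZ -scalerAl -(comp_mpolyXt x) -rmorphXn -rmorphM /=.
rewrite mpolyXn -mpolyXD submK //; apply/mnm_lepP=> j.
by rewrite mulmnE mnm1E; case: eqP => [<-|_]; rewrite ?mul1n ?mul0n.
Qed.

Lemma polynomial_ring_a_invariant :
  is_a_invariant R (- (\sum_(i < m) d i)%N%:Z).
Proof.
exists m, x, d; split; first exact: polynomial_ring_hsop.
  exact: polynomial_ring_top_neq0.
move=> _ [k [e [p [Rp homp -> nz]]]]; rewrite leNgt; apply/negP=> lt_z.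
case: nz; apply: polynomial_ring_cech_zero homp _ => //.
by rewrite -ltz_nat PoszD; move: lt_z; rewrite ltrBrDr addrC ltrBlDr.
Qed.

End AInvariant.

(** * Killing variables *)

Section Restriction.
Variable K : fieldType.

(** Composition with this tuple is reduction modulo the variables outside [J]. It stays inside the
    same polynomial ring, so that reductions compose; [kill i] is reduction modulo X_i. *)
Definition restr n (J : {set 'I_n}) : n.-tuple {mpoly K[n]} :=
  [tuple if j \in J then 'X_j else 0 | j < n].

Local Notation kill i := (restr [set~ i]).

Lemma comp_restrX n (J : {set 'I_n}) i :
  'X_i \mPo restr J = if i \in J then 'X_i else 0.
Proof. by rewrite comp_mpolyXt tnth_mktuple. Qed.

Lemma comp_killX n (i j : 'I_n) :
  'X_j \mPo kill i = if j == i then 0 else 'X_j.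
Proof. by rewrite comp_restrX !inE; case: eqP. Qed.

Lemma comp_restrI n (J J' : {set 'I_n}) (p : {mpoly K[n]}) :
  (p \mPo restr J) \mPo restr J' = p \mPo restr (J :&: J').
Proof.
rewrite comp_mpolyA; congr (_ \mPo _); apply: eq_mktuple => i.
rewrite tnth_mktuple inE; case: ifP => _ /=; last by rewrite raddf0.
by rewrite comp_restrX.
Qed.

(** Monomials free of X_i survive the substitution; all others are multiples of X_i. *)
Lemma kill_decomp n (i : 'I_n) (p : {mpoly K[n]}) :
  exists q, p = p \mPo kill i + 'X_i * q.
Proof.
rewrite {1 2}[p]mpolyE rmorph_sum /=.
elim/big_ind2: _ => [|p1 q1 p2 q2 [h1 ->] [h2 ->]|m _].
- by exists 0; rewrite mulr0 addr0.
- by exists (h1 + h2); rewrite mulrDr addrACA.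
rewrite comp_mpolyZ; case: (posnP (m i)) => [mi0|mi_gt0].
  exists 0; rewrite mulr0 addr0 comp_mpolyX mpolyXE_id; congr (_ *: _).
  apply: eq_bigr => j _; rewrite tnth_mktuple !inE.
  by case: eqP => //= ->; rewrite mi0 !expr0.
exists (p@_m *: 'X_[m - U_(i)]).
rewrite -scalerAr -mpolyXD addmC submK; last first.
  by apply/mnm_lepP=> j; rewrite mnm1E; case: eqP => // <-.
rewrite comp_mpolyX (bigD1 i) //= tnth_mktuple !inE eqxx /=.
by rewrite expr0n -[_ == _]leqn0 leqNgt mi_gt0 mul0r scaler0 add0r.
Qed.

Lemma kill_eq0 n (i : 'I_n) (p : {mpoly K[n]}) :
  p \mPo kill i = 0 -> exists q, p = 'X_i * q.
Proof. by move=> p0; have [q] := kill_decomp i p; rewrite p0 add0r;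
  exists q. Qed.

(** Since [msize] is the degree plus one, and 0 at the zero polynomial, a bound [a.+1] means degree
    at most [a] and covers zero as well. *)
Lemma msizeM_leq n (p q : {mpoly K[n]}) a b :
  (msize p <= a.+1)%N -> (msize q <= b.+1)%N -> (msize (p * q) <= (a + b).+1)%N.
Proof.
move=> pa qb; have [->|p0] := eqVneq p 0; first by rewrite mul0r msize0.
have [->|q0] := eqVneq q 0; first by rewrite mulr0 msize0.
rewrite msizeM // -ltnS prednK; last by rewrite addn_gt0 lt0n msize_poly_eq0 p0.
by rewrite (leq_trans (leq_add pa qb)) // addnS.
Qed.

Lemma msizeX_leq n (p : {mpoly K[n]}) a k :
  (msize p <= a.+1)%N -> (msize (p ^+ k) <= (a * k).+1)%N.
Proof.
move=> pa; elim: k => [|k IHk]; first by rewrite expr0 msize1 muln0.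
by rewrite exprS mulnS msizeM_leq.
Qed.

Lemma msize_sum_leq n (I : eqType) (r : seq I) (P : pred I)
    (F : I -> {mpoly K[n]}) k :
  (forall i, i \in r -> P i -> msize (F i) <= k)%N ->
  (msize (\sum_(i <- r | P i) F i) <= k)%N.
Proof.
move=> leF; rewrite big_seq_cond; elim/big_rec: _ => [|i p];
  first by rewrite msize0.
by case/andP=> ir Pi lep; rewrite (leq_trans (msizeD_le _ _)) // geq_max leF.
Qed.

Lemma msize_comp_leq n k (x : n.-tuple {mpoly K[k]}) (p : {mpoly K[n]}) :
  (forall i, msize (tnth x i) <= 2)%N -> (msize (p \mPo x) <= msize p)%N.
Proof.
move=> x2; rewrite comp_mpolyEX; apply: msize_sum_leq => m mp _.
rewrite (leq_trans (msizeZ_le _ _)) // (leq_trans _ (msize_mdeg_lt mp)) //.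
rewrite comp_mpolyX mdegE; elim/big_rec2: _ => [|i d q _ leq];
  first by rewrite msize1.
by apply: msizeM_leq => //; rewrite (leq_trans (msizeX_leq _ (x2 i))) // mul1n.
Qed.

(** * Algebraic independence by killing one variable *)

Section Independence.
Variables (n m : nat) (i : 'I_n) (j : 'I_m) (J : {set 'I_m}).
Variables x y : m.-tuple {mpoly K[n]}.

(** Killing X_i in a relation g(x) = 0 gives g(y) = 0, so the part of [g] free of X_j vanishes on
    the variables in [J]. What remains is X_j q with x_j q(x) = 0, hence q(x) = 0, and [q] is
    smaller than [g]. Only the variables in [J] are constrained, because the entries of [x] outside
    [J] are 0. *)
Lemma indep_step :
  j \in J -> (forall k, k \notin J -> tnth x k = 0) -> tnth x j != 0 ->
  (forall k, tnth x k \mPo kill i = tnth y k) ->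
  (forall g, g \mPo y = 0 -> g \mPo restr (J :\ j) = 0) ->
  forall g, g \mPo x = 0 -> g \mPo restr J = 0.
Proof.
move=> jJ xJ xj0 xy Py g; have [k] := ubnP (msize g).
elim: k g => // k IHk g; rewrite ltnS => gk gx0.
have gJ0 : (g \mPo kill j) \mPo restr J = 0.
  rewrite comp_restrI setIC -setDE; apply: Py.
  suff -> : y = [tuple tnth x k \mPo kill i | k < m].
    by rewrite -comp_mpolyA gx0 raddf0.
  by apply: eq_from_tnth => l; rewrite tnth_mktuple xy.
(* Evaluation at [x] factors through the restriction to [J], so whatever restricts to 0 also
   vanishes at [x]. *)
have xK : [tuple tnth (restr J) k \mPo x | k < m] = x.
  apply: eq_from_tnth => l; rewrite !tnth_mktuple.
  case: ifPn => [_|/xJ->]; last by rewrite raddf0.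
  by rewrite comp_mpolyXt.
have [q Dg] := kill_decomp j g.
have gx0' : (g \mPo kill j) \mPo x = 0.
  by rewrite -[x]xK -comp_mpolyA gJ0 raddf0.
have [q0|q_neq0] := eqVneq q 0.
  by rewrite Dg q0 mulr0 addr0 gJ0.
have qx0 : q \mPo x = 0.
  move: gx0; rewrite Dg rmorphD rmorphM /= gx0' add0r comp_mpolyXt => /eqP.
  by rewrite mulf_eq0 (negPf xj0) => /eqP.
rewrite Dg rmorphD rmorphM /= gJ0 add0r (IHk q) ?mulr0 //.
apply: leq_trans gk.
(* Killing X_j does not enlarge [g], so X_j q = g - (g mod X_j) is no larger than [g], and [q] is
   strictly smaller. *)
have nzX : 'X_j != 0 :> {mpoly K[m]} by rewrite -msize_poly_eq0 msizeX.
have -> : (msize q).+1 = msize ('X_j * q) by rewrite msizeM // msizeX mdeg1.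
have <- : g - (g \mPo kill j) = 'X_j * q.
  by rewrite {1}Dg addrAC subrr add0r.
rewrite (leq_trans (msizeD_le _ _)) // msizeN geq_max leqnn /=.
apply: msize_comp_leq => l; rewrite tnth_mktuple; case: ifP => _.
  by rewrite msizeX mdeg1.
by rewrite msize0.
Qed.

End Independence.
End Restriction.

(** * The conjugation action *)

Local Notation i0 := (@Ordinal 3 0 isT).
Local Notation i1 := (@Ordinal 3 1 isT).
Local Notation i2 := (@Ordinal 3 2 isT).

Section O2Action.
Variable K : finFieldType.
Local Notation T := {mpoly K[3]}.
Implicit Types (s t : {'GL_2[K]}) (p q f : T).

Local Notation kill i := (restr K [set~ i]).

Lemma mem_O2 s : (s \in O2 K) = ((GLval s)^T *m GLval s == 1%:M).
Proof.
rewrite inE; apply/eqP/eqP=> [<-|h]; first by rewrite mulVmx ?GL_unitmx.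
by rewrite -[RHS]mulmx1 -(mulmxV (GL_unitmx s)) mulmxA h mul1mx.
Qed.

Lemma O2_of_mx (A : 'M[K]_2) : A^T *m A = 1%:M ->
  exists2 s, s \in O2 K & GLval s = A.
Proof.
move=> AA; have uA : A \in unitmx by case/mulmx1_unit: AA.
have DA := SubK {'GL_2[K]} uA; exists (Sub A uA : {'GL_2[K]}) => //.
by rewrite mem_O2 DA AA.
Qed.

Lemma mx2E (R : nmodType) (A B : 'M[R]_2) :
  A 0 0 = B 0 0 -> A 0 1 = B 0 1 -> A 1 0 = B 1 0 -> A 1 1 = B 1 1 -> A = B.
Proof.
have ord2 (i : 'I_2) : i = 0 \/ i = 1.
  by case: i => [[|[|?]]] // h; [left|right]; apply: val_inj.
move=> h1 h2 h3 h4; apply/matrixP=> i j.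
by case: (ord2 i) => ->; case: (ord2 j) => ->.
Qed.

Lemma O2_rel s : s \in O2 K ->
  [/\ s 0 0 ^+ 2 + s 1 0 ^+ 2 = 1, s 0 1 ^+ 2 + s 1 1 ^+ 2 = 1
    & s 0 0 * s 0 1 + s 1 0 * s 1 1 = 0].
Proof.
rewrite mem_O2 => /eqP/matrixP h.
have := h 0 0; have := h 0 1; have := h 1 1.
rewrite !mxE !big_ord_recl !big_ord0 !mxE /= !addr0 !expr2.
by have -> : lift ord0 ord0 = 1 :> 'I_2 by apply: val_inj.
Qed.

(** The bilinear form u^tr M v of the generic symmetric matrix M at u = (x, y) and v = (z, w). The
    entries of s^tr M s are its values at pairs of columns of s. *)
Definition quad (x y z w : K) : T :=
  (x * z)%:MP * va K + (x * w + y * z)%:MP * vb K + (y * w)%:MP * vd K.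

Lemma conjME s : s \in O2 K -> forall i j,
  conjM s i j = quad (s 0 i) (s 1 i) (s 0 j) (s 1 j).
Proof.
rewrite inE => /eqP h i j; rewrite /conjM h !mxE !big_ord_recl !big_ord0.
rewrite !mxE !big_ord_recl !big_ord0 !mxE /=.
have -> : lift ord0 ord0 = 1 :> 'I_2 by apply: val_inj.
by rewrite /quad !(mpolyCD, mpolyCM) /=; ring.
Qed.

Lemma conj_actX0 s : s \in O2 K ->
  conj_act s (va K) = quad (s 0 0) (s 1 0) (s 0 0) (s 1 0).
Proof. by move=> h; rewrite /conj_act /va comp_mpolyXU /= conjME. Qed.

Lemma conj_actX1 s : s \in O2 K ->
  conj_act s (vb K) = quad (s 0 0) (s 1 0) (s 0 1) (s 1 1).
Proof. by move=> h; rewrite /conj_act /va comp_mpolyXU /= conjME. Qed.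

Lemma conj_actX2 s : s \in O2 K ->
  conj_act s (vd K) = quad (s 0 1) (s 1 1) (s 0 1) (s 1 1).
Proof. by move=> h; rewrite /conj_act /va comp_mpolyXU /= conjME. Qed.

HB.instance Definition _ s := GRing.RMorphism.copy (@conj_act K s)
  (@comp_mpoly _ _ _ [tuple conjM s 0 0; conjM s 0 1; conjM s 1 1]).

Lemma map_conj_act s : s \in O2 K -> map_mx (conj_act s) (symM K) = conjM s.
Proof.
(* Symmetry of the form is needed at the entry (1,0), where [symM] repeats b while [conjM s] has its
   columns exchanged. *)
move=> sG; have quadC x y z w : quad x y z w = quad z w x y.
  by rewrite /quad; congr (_%:MP * _ + _%:MP * _ + _%:MP * _); ring.
apply: mx2E; rewrite conjME // 2!mxE /= ?conj_actX0 ?conj_actX1 ?conj_actX2 //.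
Qed.

Lemma conj_actC s c : conj_act s c%:MP = c%:MP.
Proof. exact: comp_mpolyC. Qed.

Lemma conj_actZ s c p : conj_act s (c *: p) = c *: conj_act s p.
Proof. exact: comp_mpolyZ. Qed.

Lemma map_conj_actC s (A : 'M[K]_2) :
  map_mx (conj_act s) (map_mx (@mpolyC 3 K) A) = map_mx (@mpolyC 3 K) A.
Proof. by apply/matrixP=> i j; rewrite !mxE conj_actC. Qed.

(** Substituting s^-1 M s for M in t^-1 M t gives (st)^-1 M (st): composition of substitutions
    reverses the order, which makes this a left action. *)
Lemma conj_actM s t p : s \in O2 K -> t \in O2 K ->
  conj_act s (conj_act t p) = conj_act (s * t)%g p.
Proof.
move=> sG tG; rewrite {1 2}/conj_act comp_mpolyA; congr (_ \mPo _).
have E : map_mx (conj_act s) (conjM t) = conjM (s * t)%g.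
  rewrite {1}/conjM !map_mxM /= !map_conj_actC map_conj_act //.
  have Vst : invmx (GLval (s * t)%g) = invmx (GLval t) *m invmx (GLval s).
    by rewrite -[LHS]GL_VxE invMg.
  have -> : conjM (s * t)%g =
      map_mx (@mpolyC 3 K) (invmx (GLval t) *m invmx (GLval s)) *m symM K
        *m map_mx (@mpolyC 3 K) (GLval s *m GLval t).
    by rewrite -Vst.
  by rewrite /conjM !map_mxM /= !mulmxA.
have {}E i j : conj_act s (conjM t i j) = conjM (s * t)%g i j.
  by rewrite -E [RHS]mxE.
apply: eq_from_tnth => i; rewrite tnth_mktuple.
case: i => [[|[|[|i]]] h]; last by [].
- exact: (E 0 0).
- exact: (E 0 1).
- exact: (E 1 1).
Qed.

Lemma conj_act1 p : conj_act 1%g p = p.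
Proof.
rewrite /conj_act -[RHS]comp_mpoly_id; congr (_ \mPo _).
have E : conjM 1%g = symM K.
  by rewrite /conjM GL_1E invmx1 !map_mx1 mul1mx mulmx1.
apply: eq_from_tnth => i; rewrite tnth_mktuple E.
by case: i => [[|[|[|?]]]] // h; rewrite (tnth_nth 0) /= !mxE /=; congr 'X__;
  apply: val_inj.
Qed.

Lemma O2V s : s \in O2 K -> s^-1%g \in O2 K.
Proof.
rewrite !inE => /eqP h; apply/eqP; rewrite GL_VxE {2}h trmxK.
exact: invmxK.
Qed.

Lemma O2M s t : s \in O2 K -> t \in O2 K -> (s * t)%g \in O2 K.
Proof.
rewrite !inE => /eqP hs /eqP ht; apply/eqP.
rewrite -[LHS]GL_VxE invMg.
rewrite [LHS]GL_MxE [GLval t^-1]GL_VxE [GLval s^-1]GL_VxE hs ht.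
by rewrite -trmx_mul.
Qed.

Lemma O2_1 : 1%g \in O2 K.
Proof. by rewrite inE GL_1E invmx1 trmx1. Qed.

Lemma conj_actK s : s \in O2 K -> cancel (@conj_act K s) (conj_act s^-1%g).
Proof.
move=> sG p; rewrite (conj_actM _ (O2V sG) sG) (mulVg s).
exact: conj_act1.
Qed.

Lemma conj_actVK s : s \in O2 K -> cancel (conj_act s^-1%g) (@conj_act K s).
Proof.
move=> sG p; rewrite (conj_actM _ sG (O2V sG)) (mulgV s).
exact: conj_act1.
Qed.

Lemma invariantsP p :
  reflect (forall s, s \in O2 K -> conj_act s p = p) (p \in invariants K).
Proof.
apply: (iffP forall_inP) => h s sG; first exact/eqP/h.
by apply/eqP/h.
Qed.

Lemma trace_invariant : va K + vd K \in invariants K.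
Proof.
apply/invariantsP=> s sG; rewrite -tr_symM -trace_map_mx map_conj_act //.
rewrite /conjM -mulmxA mxtrace_mulC -mulmxA -map_mxM (mulmxV (GL_unitmx s)).
by rewrite map_mx1 mulmx1.
Qed.

Lemma det_invariant : va K * vd K - vb K ^+ 2 \in invariants K.
Proof.
apply/invariantsP=> s sG; rewrite -det_symM -det_map_mx map_conj_act //.
rewrite /conjM !det_mulmx mulrAC -det_mulmx -map_mxM (mulVmx (GL_unitmx s)).
by rewrite map_mx1 det1 mul1r.
Qed.

Lemma quad_homog x y z w : quad x y z w \is 1.-homog.
Proof.
have homX (c : K) (i : 'I_3) : c *: ('X_i : T) \is 1.-homog.
  by apply: rpredZ; rewrite dhomogX /= mdeg1.
by rewrite /quad !mul_mpolyC; do 2?[apply: rpredD]; apply: homX.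
Qed.

Lemma conj_actX_homog s i : s \in O2 K -> conj_act s 'X_i \is 1.-homog.
Proof.
move=> sG; rewrite /conj_act comp_mpolyXt.
by case: i => [[|[|[|?]]]] // h; rewrite (tnth_nth 0) /= conjME // quad_homog.
Qed.

Lemma conj_act_neq0 s p : s \in O2 K -> p != 0 -> conj_act s p != 0.
Proof.
move=> sG; apply: contraNneq => p0.
by rewrite -(conj_actK sG p) p0 rmorph0.
Qed.

Lemma msizeXU (n : nat) (i : 'I_n) : msize ('X_i : {mpoly K[n]}) = 2%N.
Proof. by rewrite msizeX mdeg1. Qed.

Lemma mpolyXU_neq0 (n : nat) (i : 'I_n) : 'X_i != 0 :> {mpoly K[n]}.
Proof. by rewrite -msize_poly_eq0 msizeXU. Qed.

Definition conj_orbit p : seq T := undup [seq conj_act s p | s in O2 K].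

Lemma conj_orbitP p f :
  reflect (exists2 s : {'GL_2[K]},
    s \in O2 K & f = conj_act s p) (f \in conj_orbit p).
Proof.
rewrite mem_undup; apply: (iffP imageP) => [[s]|[s sG ->]]; first by exists s.
by exists s.
Qed.

Lemma orbit_prod_invariant p : orbit_prod p \in invariants K.
Proof.
apply/invariantsP=> s sG; rewrite /orbit_prod -/(conj_orbit p) rmorph_prod /=.
rewrite -(big_map _ xpredT id) /=; apply: perm_big; apply: uniq_perm.
- by rewrite map_inj_uniq ?undup_uniq //; apply: can_inj (conj_actK sG).
- exact: undup_uniq.
move=> f; apply/mapP/conj_orbitP => [[g /conj_orbitP[t tG ->] ->]|[t tG ->]].
  exists (s * t)%g; [apply: (O2M sG tG) | apply: (conj_actM p sG tG)].
exists (conj_act s^-1%g (conj_act t p)); last by rewrite conj_actVK.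
apply/conj_orbitP; exists (s^-1 * t)%g; first apply: (O2M (O2V sG) tG).
apply: (conj_actM p (O2V sG) tG).
Qed.

(** * Divisibility by the orbit product of a variable, and generation of the invariants *)

Section OrbitOfVariable.
Variable i : 'I_3.

Lemma orbitX_neq0 : orbit_prod ('X_i : T) != 0.
Proof.
rewrite /orbit_prod -/(conj_orbit _) prodf_seq_neq0;
  apply/allP=> f /conj_orbitP[s sG ->].
by rewrite conj_act_neq0 ?mpolyXU_neq0.
Qed.

Lemma orbitX_homog : orbit_prod ('X_i : T) \is (size (conj_orbit ('X_i :
  T))).-homog.
Proof.
rewrite /orbit_prod -/(conj_orbit _) -sum1_size.
rewrite big_seq [in X in X.-homog]big_seq.
elim/big_ind2: _ => // [|p d q e|f /conj_orbitP[s sG ->]]; first exact: dhomog1.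
  exact: dhomogM.
exact: conj_actX_homog.
Qed.

Lemma orbitX_msize : msize (orbit_prod ('X_i :
  T)) = (size (conj_orbit ('X_i : T))).+1.
Proof.
have h := dhomog_uniq orbitX_neq0 (dhomog_msize orbitX_homog) orbitX_homog.
by rewrite -h prednK // lt0n msize_poly_eq0 orbitX_neq0.
Qed.

Lemma orbitX_gt0 : (0 < size (conj_orbit ('X_i : T)))%N.
Proof.
have : ('X_i : T) \in conj_orbit 'X_i.
  by apply/conj_orbitP; exists 1%g; rewrite ?O2_1 ?conj_act1.
by case: conj_orbit.
Qed.

(* No other element of the orbit is proportional to 'X_i. *)
Hypothesis fixX : forall s, s \in O2 K ->
  conj_act s 'X_i \mPo kill i = 0 -> conj_act s 'X_i = 'X_i.

Lemma orbit_prod_dvd p : p \in invariants K -> p \mPo kill i = 0 ->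
  exists h, p = orbit_prod 'X_i * h.
Proof.
move/invariantsP=> pG pi0; rewrite /orbit_prod -/(conj_orbit _).
have: {subset conj_orbit 'X_i <= conj_orbit 'X_i} by [].
have: uniq (conj_orbit 'X_i) by apply: undup_uniq.
(* Induction over duplicate-free sublists of the orbit: the product over each of them divides
   [p]. *)
elim: {1 2 4}(conj_orbit 'X_i) => [|f l IHl] /= => [_ _|/andP[fl ul] lO].
  by exists p; rewrite big_nil mul1r.
have lO' : {subset l <= conj_orbit 'X_i} by move=> g gl; apply: lO;
  rewrite inE gl orbT.
have [h Dp] := IHl ul lO'.
have /conj_orbitP[s sG Df] := lO f (mem_head _ _).
have sG' := O2V sG.
have: conj_act s^-1%g p \mPo kill i = 0 by rewrite (pG _ sG').
rewrite Dp !rmorphM /= !rmorph_prod => /= /eqP.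
(* Transport by s^-1 moves the new factor [f] to X_i. Either an earlier factor [g] is moved to a
   form vanishing modulo X_i, and [fixX] forces g = f, against uniqueness; or X_i divides the
   transported cofactor, so that [f] divides [h]. *)
rewrite mulf_eq0 prodf_seq_eq0 => /orP[/hasP[g gl /eqP]|/eqP/kill_eq0[q Dq]].
  have /conj_orbitP[t tG Dg] := lO' g gl.
  rewrite Dg (conj_actM _ sG' tG) => /(fixX (O2M sG' tG)).
  move/(congr1 (conj_act s)); rewrite -(conj_actM _ sG' tG) (conj_actVK sG)
    -Dg -Df => Dg'.
  by rewrite -Dg' gl in fl.
exists (conj_act s q); rewrite big_cons -[h](conj_actVK sG) Dq rmorphM /= -Df.
by rewrite mulrCA mulrA.
Qed.

Variables (c : K) (f3 : T).
Hypotheses (c0 : c != 0) (Df3 : f3 = c *: orbit_prod 'X_i).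
Local Notation x := [tuple va K + vd K; va K * vd K - vb K ^+ 2; f3].

Hypothesis reduction : forall p, p \in invariants K -> exists r,
  [/\ Defs.in_alg x r, (msize r <= msize p)%N & (p - r) \mPo kill i = 0].

Lemma f3_invariant : f3 \in invariants K.
Proof.
apply/invariantsP=> s sG; rewrite Df3 conj_actZ.
by rewrite (invariantsP _ (orbit_prod_invariant _)).
Qed.

Lemma in_alg_invariant p : Defs.in_alg x p -> p \in invariants K.
Proof.
case=> g ->; apply/invariantsP=> s sG; rewrite /conj_act comp_mpolyA.
congr (_ \mPo _); apply: eq_from_tnth => j; rewrite tnth_mktuple.
have /(_ s sG) := invariantsP _ f3_invariant.
have /(_ s sG) := invariantsP _ trace_invariant.
have /(_ s sG) := invariantsP _ det_invariant.
rewrite /conj_act => h1 h2 h3.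
by case: j => [[|[|[|?]]]] // h; rewrite (tnth_nth 0) /=.
Qed.

(** Induction on the size. Write p - r = f_3 h; cancelling the invariant f_3 shows that [h] is
    invariant. The bound on the size of [r] makes [h] smaller than [p], as the orbit product has
    positive degree. *)
Lemma invariants_generated p : p \in invariants K <-> Defs.in_alg x p.
Proof.
split; last exact: in_alg_invariant.
have [k] := ubnP (msize p); elim: k p => // k IHk p; rewrite ltnS => pk pG.
have [r [[g Dr] rp pr0]] := reduction pG.
have rG : r \in invariants K by apply: in_alg_invariant; exists g.
have prG : p - r \in invariants K.
  apply/invariantsP=> s sG; rewrite rmorphB /=.
  by rewrite (invariantsP _ pG) // (invariantsP _ rG).
have f3_neq0 : f3 != 0 by rewrite Df3 scaler_eq0 negb_or c0 orbitX_neq0.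
have [h Dpr] : exists h, p - r = f3 * h.
  have [h ->] := orbit_prod_dvd prG pr0; exists (c^-1 *: h).
  by rewrite Df3 -scalerAl -scalerAr scalerA mulfV // scale1r.
have hG : h \in invariants K.
  apply/invariantsP=> s sG; apply: (mulfI f3_neq0).
  rewrite -Dpr -[in LHS](invariantsP _ f3_invariant s sG) -rmorphM /= -Dpr.
  by rewrite (invariantsP _ prG).
have [h0|h_neq0] := eqVneq h 0.
  by exists g; apply/eqP; rewrite -Dr -subr_eq0 Dpr h0 mulr0.
have [|g' Dh] := IHk h _ hG.
  apply: leq_trans pk.
  have : (msize (p - r) <= msize p)%N.
    by rewrite (leq_trans (msizeD_le _ _)) // msizeN geq_max leqnn.
  rewrite Dpr msizeM // Df3 msizeZ // orbitX_msize addSn /=.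
  by apply: leq_trans; rewrite -{1}[msize h]add0n ltn_add2r orbitX_gt0.
exists (g + 'X_(@Ordinal 3 2 isT) * g').
rewrite rmorphD rmorphM /= -Dr -Dh comp_mpolyXt (tnth_nth 0) /= -Dpr.
by rewrite addrC subrK.
Qed.

End OrbitOfVariable.
End O2Action.

(** * Counting points and orbits *)

(** Double counting of the pairs (x, y) with f x = y. *)
Lemma card_undup_fibers (I : finType) (J : eqType) (A : {set I}) (f :
  I -> J) k :
  (forall x, x \in A -> #|[set y in A | f y == f x]| = k) ->
  #|A| = (k * size (undup [seq f x | x in A]))%N.
Proof.
move=> fibk; set s := undup _.
have fs x : x \in A -> f x \in s by move=> Ax; rewrite mem_undup image_f.
have -> : #|A| = (\sum_(x in A) \sum_(y <- s) (f x == y))%N.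
  rewrite -sum1_card; apply: eq_bigr => x Ax.
  rewrite -(big_mkcond (fun y => f x == y) (fun=> 1%N)) sum1_count.
  by rewrite (eq_count (a2 := pred1 (f x))) ?count_uniq_mem ?undup_uniq ?fs
    // => y /=; rewrite eq_sym.
rewrite exchange_big /= mulnC -sum1_size big_distrl /= big_seq [RHS]big_seq.
apply: eq_bigr => y; rewrite mem_undup => /imageP[x Ax ->].
rewrite mul1n -(fibk x Ax) -sum1_card -big_mkcondr /=.
by apply: eq_bigl => z; rewrite inE.
Qed.

(** * The number of points of the circle over a finite field *)

Section Circle.
Variable K : finFieldType.

Definition circle : {set K * K} := [set u | u.1 ^+ 2 + u.2 ^+ 2 == 1].

Lemma circleP x y : ((x, y) \in circle) = (x ^+ 2 + y ^+ 2 == 1).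
Proof. by rewrite inE. Qed.

Lemma odd_two_neq0 : odd #|K| -> 2%:R != 0 :> K.
Proof.
move=> oddK; apply/negP=> two0.
have ch2 : 2%N \in [pchar K] by rewrite inE /=.
have := card_pprimeChar ch2; have := finNzRing_gt1 K.
by case: logn => [|n] K1 cK; rewrite cK ?expnS ?oddM in K1 oddK.
Qed.

Hypothesis two_neq0 : 2%:R != 0 :> K.

Lemma neq_opp (x : K) : x != 0 -> x != - x.
Proof.
by rewrite -addr_eq0 -mulr2n -mulr_natl mulf_eq0 (negPf two_neq0).
Qed.

(** Stereographic projection from (-1, 0): the map [g] is a bijection from the u with u^2 + 1
    nonzero onto the circle without (-1, 0). *)
Lemma card_circle_sqrtN1 :
  (#|circle| + #|[set u : K | (u ^+ 2 == -1)%R]| = #|K|.+1)%N.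
Proof.
have eqN1 : (-1, 0) \in circle by rewrite circleP expr0n addr0 sqrrN expr1n.
pose S := [set u : K | u ^+ 2 + 1 != 0].
pose g (u : K) := ((1 - u ^+ 2) / (u ^+ 2 + 1), 2%:R * u / (u ^+ 2 + 1)).
have gE : circle :\ (-1, 0) = g @: S.
  apply/setP=> -[x y]; rewrite in_setD1 circleP; apply/andP/imsetP.
    case=> ne /eqP xy; have x1 : x + 1 != 0.
      apply: contra ne; rewrite addr_eq0 => /eqP Dx; move/eqP: xy.
      rewrite Dx sqrrN expr1n addrC -subr_eq0 addrK sqrf_eq0 => /eqP->.
      by rewrite eqxx.
    have y2 : y ^+ 2 = 1 - x ^+ 2 by rewrite -xy addrAC subrr add0r.
    have E : (y / (x + 1)) ^+ 2 + 1 = 2%:R / (x + 1).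
      by rewrite expr_div_n y2; field.
    (* The parameter is the slope of the line through (-1, 0) and (x, y). *)
    exists (y / (x + 1)); first by rewrite inE E mulf_neq0 ?invr_eq0.
    rewrite /g E; congr (_, _); last by field; rewrite x1 two_neq0.
    by rewrite expr_div_n y2; field; rewrite x1 two_neq0.
  case=> u; rewrite inE => u1 [-> ->]; split.
    rewrite xpair_eqE negb_and; apply/orP; left.
    apply: contra two_neq0 => /eqP/(congr1 (fun z => z * (u ^+ 2 + 1))).
    rewrite mulfVK // mulN1r => h.
    by apply/eqP; rewrite -[RHS](subrr (1 - u ^+ 2)) {2}h; ring.
  by apply/eqP; field.
have gI : {in S &, injective g}.
  move=> u v; rewrite !inE => u1 v1 [].
  (* The first coordinate plus 1 is 2/(u^2 + 1), and the second coordinate is u times this nonzero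
     factor. *)
  move=> /(congr1 (fun z => z + 1)) e1 /esym; rewrite /= in e1 *.
  have E (w : K) : w ^+ 2 + 1 != 0 -> (1 - w ^+ 2) / (w ^+ 2 + 1) + 1 = 2%:R
    / (w ^+ 2 + 1).
    by move=> w1; field.
  rewrite !E // in e1; rewrite ![2%:R * _]mulrC -!mulrA -e1 => /mulIf -> //.
  by rewrite mulf_neq0 ?invr_eq0.
rewrite [in LHS](cardsD1 (-1, 0)) eqN1 gE (card_in_imset gI) -addnA add1n.
congr _.+1; rewrite -cardsT -(cardsID S setT) setTI; congr (_ + _)%N.
by apply: eq_card => u; rewrite !inE andbT negbK addr_eq0.
Qed.

Hypothesis oddK : odd #|K|.
Let m := ((#|K| - 1) %/ 2)%N.

Lemma card_field_half : #|K| = (2 * m + 1)%N.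
Proof.
rewrite /m -{1}[#|K|]odd_double_half oddK -muln2 addnC mulnC.
by rewrite -{2}[#|K|]odd_double_half oddK addKn -muln2 mulnK.
Qed.

(** With q = 2m + 1, u = u^q = (-1)^m u, and u is nonzero. *)
Lemma sqrtN1_half_even (u : K) : u ^+ 2 = -1 -> ~~ odd m.
Proof.
move=> u2; apply/negP=> om.
have := expf_card u; rewrite card_field_half exprD exprM u2 -signr_odd om expr1.
move=> /esym/eqP; rewrite mulN1r; apply/negP/neq_opp; apply/eqP=> u0;
  move/eqP: u2.
by rewrite u0 expr0n eq_sym oppr_eq0 oner_eq0.
Qed.

(** X^m - 1 has at most m roots, fewer than the 2m nonzero elements. A nonzero x with x^m different
    from 1 has x^(2m) = 1, hence x^m = -1, and x^(m/2) is the root sought. *)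
Lemma half_even_sqrtN1 : ~~ odd m -> exists u : K, u ^+ 2 = -1.
Proof.
move=> em; have m_gt0 : (0 < m)%N.
  by have := finNzRing_gt1 K; rewrite card_field_half; case: m.
have [x x0 xm] : exists2 x : K, x != 0 & x ^+ m != 1.
  apply/exists_inP; apply: contraT; rewrite negb_exists_in => /forall_inP xm.
  have p0 : 'X^m - 1 != 0 :> {poly K} by rewrite -size_poly_eq0 size_XnsubC.
  have : (size (enum [set~ 0%R : K]) < size ('X^m - 1 : {poly K})%R)%N.
    apply: max_poly_roots p0 _ (enum_uniq _); apply/allP=> x.
    rewrite mem_enum !inE => x0.
    by rewrite /root !hornerE subr_eq0 -[_ == _]negbK xm.
  rewrite -cardE cardsC1 card_field_half addn1 size_XnsubC // ltnS mul2n -addnn.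
  by rewrite leqNgt -[X in (X < _)%N]addn0 ltn_add2l m_gt0.
have x2m : x ^+ m * x ^+ m = 1.
  apply: (mulfI x0); rewrite -exprD -exprS addnn -mul2n -addn1 -card_field_half.
  by rewrite expf_card mulr1.
exists (x ^+ m./2); rewrite -exprM muln2.
have -> : m./2.*2 = m by rewrite -[RHS]odd_double_half (negPf em).
apply/eqP; rewrite -addr_eq0; apply/eqP.
have : x ^+ m - 1 != 0 by rewrite subr_eq0.
move/mulfI; apply; rewrite mulr0 -[RHS](subrr 1) -{3}x2m.
by ring.
Qed.

Lemma card_circle : #|circle| = if odd m then #|K|.+1 else #|K|.-1.
Proof.
have := card_circle_sqrtN1; case: ifPn => om.
  rewrite (_ : [set u : K | _] = set0) ?cards0 ?addn0 //.
  by apply/setP=> u; rewrite !inE; apply/eqP=> /sqrtN1_half_even; rewrite om.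
have [u u2] := half_even_sqrtN1 om.
rewrite (_ : [set v : K | _] = [set u; - u]).
  rewrite cards2 neq_opp; last first.
    by apply: contraTneq (oner_neq0 K) => u0;
      rewrite -oppr_eq0 -u2 u0 expr0n eqxx.
  by rewrite addn2 => -[<-].
by apply/setP=> v; rewrite !inE -u2 eqf_sqr.
Qed.

End Circle.

(** * Orthogonal matrices by columns, and the orbit of a *)

Section Counting.
Variable K : finFieldType.
Local Notation T := {mpoly K[3]}.
Local Notation kill i := (restr K [set~ i]).
Implicit Types (s t : {'GL_2[K]}).

Lemma quad_inj x y z w x' y' z' w' : quad x y z w = quad x' y' z' w' :> T ->
  [/\ x * z = x' * z', x * w + y * z = x' * w' + y' * z' & y * w = y' * w'].
Proof.
move=> e.
have cE i := congr1 (mcoeff U_(i)) e.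
move: (cE i0) (cE i1) (cE i2); rewrite /quad !mcoeffD !mcoeffCM !mcoeffXU /=.
by rewrite !(mulr0, mulr1, addr0, add0r) => -> -> ->.
Qed.

(** [quad 0 1 z w] is the linear form z b + w d; in this shape [quad_inj] reads off its
    coefficients. *)
Lemma quad_kill0 x y z w :
  quad x y z w \mPo kill i0 = quad 0 1 (x * w + y * z) (y * w) :> T.
Proof.
rewrite /quad !mul_mpolyC !comp_mpolyD !comp_mpolyZ !comp_killX /=.
by rewrite !(mul0r, mul1r, scaler0, scale0r, add0r).
Qed.

Lemma GL2E s t : s 0 0 = t 0 0 -> s 0 1 = t 0 1 -> s 1 0 = t 1 0 ->
  s 1 1 = t 1 1 -> s = t.
Proof. by move=> *; apply: val_inj; apply: mx2E. Qed.

Definition mx2 (x y z w : K) : 'M[K]_2 :=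
  \matrix_(i, j) if i == 0 then (if j == 0 then x else z)
                 else (if j == 0 then y else w).

Lemma O2_exists x y z w :
  x ^+ 2 + y ^+ 2 = 1 -> z ^+ 2 + w ^+ 2 = 1 -> x * z + y * w = 0 ->
  exists2 s : {'GL_2[K]}, s \in O2 K & [/\ s 0 0 = x, s 1 0 = y,
    s 0 1 = z & s 1 1 = w].
Proof.
move=> xy zw xyzw; have [|s sG sE] := @O2_of_mx K (mx2 x y z w).
  have l1 : lift ord0 ord0 = 1 :> 'I_2 by apply: val_inj.
  apply: mx2E; rewrite !mxE !big_ord_recl !big_ord0 !mxE /= ?l1 /= !addr0.
  - by rewrite -!expr2 xy.
  - by rewrite xyzw.
  - by rewrite mulrC [w * y]mulrC xyzw.
  - by rewrite -!expr2 zw.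
by exists s => //; rewrite sE !mxE.
Qed.

(** The sign [e] is the determinant; its square is 1 by the Lagrange identity, and the two equations
    are combinations of the orthonormality relations. *)
Lemma O2_second_column s : s \in O2 K ->
  exists2 e : K, e ^+ 2 = 1 & s 0 1 = - e * s 1 0 /\ s 1 1 = e * s 0 0.
Proof.
move=> /O2_rel[]; set x := s 0 0; set y := s 1 0; set z := s 0 1;
  set w := s 1 1.
move=> xy zw xyzw; exists (x * w - y * z); last split.
- rewrite (_ : _ ^+ 2 = (x ^+ 2 + y ^+ 2) * (z ^+ 2 + w ^+ 2) - (x * z +
    y * w) ^+ 2); last by ring.
  by rewrite xy zw xyzw expr0n mulr1 subr0.
- rewrite (_ : - _ * y = (x ^+ 2 + y ^+ 2) * z - x * (x * z + y * w));
  last by ring.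
  by rewrite xy xyzw; ring.
rewrite (_ : _ * x = (x ^+ 2 + y ^+ 2) * w - y * (x * z + y * w)); last by ring.
by rewrite xy xyzw; ring.
Qed.

Section OddCount.
Hypothesis two_neq0 : 2%:R != 0 :> K.

(** The first column runs over the whole circle, every point being completed by a rotation, and it
    determines the second column up to sign. *)
Lemma card_O2_circle : #|O2 K| = (2 * #|circle K|)%N.
Proof.
pose col s : K * K := (s 0 0, s 1 0).
have fib s : s \in O2 K -> #|[set t in O2 K | col t == col s]| = 2.
  move=> sG.
  have [xy zw xyzw] := O2_rel sG.
  have [|||s' sG' [e1 e2 e3 e4]] :=
    @O2_exists (s 0 0) (s 1 0) (- s 0 1) (- s 1 1) => //.
  - by rewrite !sqrrN.
  - by rewrite !mulrN -opprD xyzw oppr0.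
  have ne : s != s'.
    apply/eqP=> ss'; move: e3 e4; rewrite -ss' => /eqP z0 /eqP w0.
    have z00 : s 0 1 = 0 by apply: contraTeq z0 => /(neq_opp two_neq0).
    have w00 : s 1 1 = 0 by apply: contraTeq w0 => /(neq_opp two_neq0).
    by move/eqP: zw; rewrite z00 w00 !expr0n addr0 eq_sym oner_eq0.
  have -> : [set t in O2 K | col t == col s] = [set s; s'].
    apply/setP=> t; rewrite in_set2 in_set; apply/andP/orP.
      case=> tG /eqP[t1 t2].
      have [e ee [ez ew]] := O2_second_column sG.
      have [f ff [fz fw]] := O2_second_column tG.
      have /orP[/eqP ef|/eqP ef] :
        (f == e) || (f == - e) by rewrite -eqf_sqr ee ff.
        by left; apply/eqP/GL2E; rewrite ?fz ?fw ?ez ?ew ?t1 ?t2 ?ef.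
      right; apply/eqP/GL2E; rewrite ?e1 ?e2 ?e3 ?e4 //.
        by rewrite fz ez ef t2; ring.
      by rewrite fw ew ef t1; ring.
    by case=> /eqP->; split=> //; rewrite /col e1 e2.
  by rewrite cards2 ne.
rewrite (card_undup_fibers fib); congr (2 * _)%N; rewrite cardE;
  apply: perm_size; apply: uniq_perm.
- exact: undup_uniq.
- exact: enum_uniq.
move=> [x y]; rewrite mem_undup mem_enum circleP; apply/imageP/eqP.
  by case=> s /O2_rel[xy _ _] [-> ->].
move=> xy; have [|||s sG [s1 s2 _ _]] := @O2_exists x y (- y) x => //.
- by rewrite sqrrN addrC.
- by ring.
by exists s => //; rewrite /col s1 s2.
Qed.

Lemma mem_orbit_va f : reflect
  (exists2 u, u \in circle K & f = quad u.1 u.2 u.1 u.2)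
  (f \in conj_orbit (va K)).
Proof.
apply: (iffP (conj_orbitP _ _)) => [[s sG ->]|[[x y]]].
  exists (s 0 0, s 1 0); last exact: conj_actX0.
  by rewrite circleP; have [->] := O2_rel sG.
rewrite circleP => /eqP xy ->; have [|||s sG [s1 s2 _ _]] := @O2_exists x y
  (- y) x => //.
- by rewrite sqrrN addrC.
- by ring.
by exists s => //; rewrite conj_actX0 // s1 s2.
Qed.

(** The form attached to (x, y) has coefficients x^2, 2xy, y^2, which determine (x, y) exactly up to
    a common sign. *)
Lemma card_circle_orbit : #|circle K| = (2 * size (conj_orbit (va K)))%N.
Proof.
rewrite (@card_undup_fibers _ _ (circle K) (fun u => quad u.1 u.2 u.1 u.2) 2).
  congr (2 * _)%N; apply: perm_size; apply: uniq_perm; rewrite ?undup_uniq //.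
  move=> f; rewrite mem_undup; apply/imageP/mem_orbit_va; first by case=> u;
    exists u.
  by case=> u; exists u.
move=> [x y]; rewrite circleP => /eqP xy /=.
have -> : [set u in circle K | quad u.1 u.2 u.1 u.2 == quad x y x y]
    = [set (x, y); (- x, - y)].
  apply/setP=> -[z w]; rewrite in_set2 in_set circleP; apply/andP/orP => /=.
    case=> _ /eqP/quad_inj[/eqP e1 e2 /eqP e3].
    have {}e2 : z * w = x * y.
      by apply: (mulfI two_neq0);
        rewrite !mulr_natl !mulr2n {2}mulrC e2 [y * x]mulrC.
    move: e1 e3; rewrite -!expr2 !eqf_sqr !xpair_eqE.
    have [x0 | x_neq0] := eqVneq x 0; first by rewrite x0 oppr0 orbb => -> /orP.
    case/orP=> /eqP z_x _; rewrite z_x eqxx /=; [left | right]; apply/eqP.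
      by apply: (mulfI x_neq0); rewrite -e2 z_x.
    by apply: (mulfI x_neq0); rewrite mulrN -e2 z_x mulNr opprK.
  case=> /eqP[-> ->]; first by rewrite xy !eqxx.
  rewrite !sqrrN xy eqxx; split=> //; apply/eqP.
  by rewrite /quad !mulrNN.
rewrite cards2 xpair_eqE negb_and.
have [x0|x0] := eqVneq x 0; last by rewrite (neq_opp two_neq0 x0).
have y0 : y != 0.
  by apply: contra_eq_neq xy => ->; rewrite x0 !expr0n addr0 eq_sym oner_neq0.
by rewrite (neq_opp two_neq0 y0) orbT.
Qed.

End OddCount.
End Counting.

(** * Orbit elements proportional to the variable, and the orbit of b in characteristic 2 *)

Section Fix.
Variable K : finFieldType.
Local Notation T := {mpoly K[3]}.
Local Notation kill i := (restr K [set~ i]).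
Implicit Types (s t : {'GL_2[K]}).

(** Modulo a, the form of (x, y) is 2xy b + y^2 d. Its vanishing forces y = 0, then x^2 = 1, and the
    form is a. *)
Lemma conj_fix_va s : s \in O2 K ->
  conj_act s (va K) \mPo kill i0 = 0 -> conj_act s (va K) = va K.
Proof.
move=> sG; have [xy _ _] := O2_rel sG; rewrite conj_actX0 // quad_kill0 => h.
have /quad_inj[_ _] : quad 0 1 (s 0 0 * s 1 0 + s 1 0 * s 0 0) (s 1 0 * s 1 0)
    = quad 0 0 0 0 by rewrite h /quad !(mulr0, addr0, rmorph0, mul0r).
rewrite mul1r mul0r => /eqP; rewrite mulf_eq0 orbb => /eqP y0.
move: xy; rewrite y0 expr0n addr0 expr2 => x1.
by rewrite /quad x1 !(mulr0, addr0, rmorph0, rmorph1, mul0r, mul1r).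
Qed.

Section Even.
Hypothesis two0 : 2%:R = 0 :> K.
Variable e : nat.
Hypothesis cardK : #|K| = (2 ^ e.+1)%N.

Lemma pchar2 : 2%N \in [pchar K].
Proof. by rewrite inE /= two0 eqxx. Qed.

Lemma opp2 (x : K) : - x = x.
Proof. exact: oppr_pchar2 pchar2 x. Qed.

Lemma pcharT : 2%N \in [pchar T].
Proof. by rewrite inE /= -mpolyC_nat two0 mpolyC0 eqxx. Qed.

Lemma sqr_inj2 (x y : K) : x ^+ 2 = y ^+ 2 -> x = y.
Proof. by move/eqP; rewrite eqf_sqr opp2 orbb => /eqP. Qed.

(** In characteristic 2 a sum of squares is the square of the sum, so each column has entries adding
    up to 1; orthogonality then reduces to w = y + 1. The group is thus parametrized by one entry
    ranging over K. *)
Lemma O2_evenE s : s \in O2 K ->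
  [/\ s 0 0 = s 1 0 + 1, s 0 1 = s 1 0 & s 1 1 = s 1 0 + 1].
Proof.
move/O2_rel; set x := s 0 0; set y := s 1 0; set z := s 0 1; set w := s 1 1.
have add2 (u v : K) : u ^+ 2 + v ^+ 2 = (u + v) ^+ 2.
  by rewrite sqrrD -mulr_natl two0 mul0r addr0.
rewrite !add2 => -[xy zw xyzw].
have one (u v : K) : (u + v) ^+ 2 = 1 -> u = v + 1.
  rewrite -[X in _ = X -> _](expr1n _ 2) => /sqr_inj2 <-.
  by rewrite addrCA -mulr2n -mulr_natl two0 mul0r addr0.
have Dx := one _ _ xy; have Dz := one _ _ zw.
have Dw : w = y + 1.
  have : (y + 1) * (w + 1) + y * w = 0 by rewrite -Dx -Dz.
  rewrite (_ : _ + _ = 2%:R * (y * w) + (w + (y + 1))); last by ring.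
  by rewrite two0 mul0r add0r => /eqP; rewrite addr_eq0 opp2 => /eqP.
by split=> //; rewrite Dz Dw -addrA -mulr2n two0 addr0.
Qed.

Lemma O2_even_inj : {in O2 K &, injective (fun s : {'GL_2[K]} => s 1 0)}.
Proof.
move=> s t sG tG /= st; have [s1 s2 s3] := O2_evenE sG.
have [t1 t2 t3] := O2_evenE tG.
by apply: GL2E; rewrite ?s1 ?s2 ?s3 ?t1 ?t2 ?t3 st.
Qed.

Lemma O2_even_exists u : exists2 s : {'GL_2[K]}, s \in O2 K & s 1 0 = u.
Proof.
have [|||s sG [_ s1 _ _]] := @O2_exists K (u + 1) u u (u + 1); last by exists s.
- rewrite (_ : _ + _ = 2%:R * (u ^+ 2 + u) + 1); last by ring.
  by rewrite two0 mul0r add0r.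
- rewrite (_ : _ + _ = 2%:R * (u ^+ 2 + u) + 1); last by ring.
  by rewrite two0 mul0r add0r.
rewrite (_ : _ + _ = 2%:R * (u ^+ 2 + u)); last by ring.
by rewrite two0 mul0r.
Qed.

Lemma card_O2_even : #|O2 K| = #|K|.
Proof.
rewrite -(card_in_imset O2_even_inj) -cardsT; apply: eq_card => u.
rewrite in_setT; apply/imsetP.
by have [s sG <-] := O2_even_exists u; exists s.
Qed.

(** The orbit of b consists of these forms with w = u^2 + u, where u is the entry (1,0) of the
    acting matrix. *)
Definition shear (w : K) : T := vb K + w%:MP * (va K + vd K).

Lemma conj_act_vb_even s : s \in O2 K ->
  conj_act s (vb K) = shear (s 1 0 ^+ 2 + s 1 0).
Proof.
move=> sG; have [s1 s2 s3] := O2_evenE sG.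
rewrite conj_actX1 // s1 s2 s3; set u := s 1 0.
rewrite /quad (_ : _ * _ + u * u = 2%:R * (u ^+ 2 + u) + 1); last by ring.
rewrite two0 mul0r add0r mpolyC1 mul1r /shear.
rewrite (_ : _ * u = u ^+ 2 + u); last by ring.
by rewrite (_ : u * _ = u ^+ 2 + u) //; ring.
Qed.

Lemma shear_inj : injective shear.
Proof.
move=> w w' /(congr1 (mcoeff U_(i0))).
by rewrite /shear !mcoeffD !mcoeffCM !mcoeffD !mcoeffXU /= !add0r addr0 !mulr1.
Qed.

Lemma conj_fix_vb s : s \in O2 K ->
  conj_act s (vb K) \mPo kill i1 = 0 -> conj_act s (vb K) = vb K.
Proof.
move=> sG; rewrite conj_act_vb_even // /shear; set w := s 1 0 ^+ 2 + _.
rewrite mul_mpolyC comp_mpolyD comp_mpolyZ comp_mpolyD !comp_killX /= add0r.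
move/(congr1 (mcoeff U_(i0))); rewrite mcoeffZ mcoeffD !mcoeffXU /= addr0
  mulr1 => ->.
by rewrite mcoeff0 scale0r addr0.
Qed.

(** The additive map sending u to u^2 + u has kernel {0, 1}, so its fibres are the pairs {v, v +
    1}. *)
Lemma card_O2_orbit_even : #|O2 K| = (2 * size (conj_orbit (vb K)))%N.
Proof.
have fib s : s \in O2 K ->
    #|[set t in O2 K | conj_act t (vb K) == conj_act s (vb K)]| = 2.
  move=> sG; have [s1 s2 s3] := O2_evenE sG; set v := s 1 0 in s1 s2 s3.
  have [s' s'G Ds'] := O2_even_exists (v + 1).
  have -> : [set t in O2 K | conj_act t (vb K) == conj_act s (vb K)]
      = [set s; s'].
    apply/setP=> t; rewrite in_set2 in_set; apply/andP/orP.
      case=> tG; rewrite !conj_act_vb_even // => /eqP/shear_inj;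
        rewrite -/v => tv.
      have : (GLval t 1 0 - v) * (GLval t 1 0 - (v + 1)) = 0.
        rewrite (_ : _ * _ = GLval t 1 0 ^+ 2 + GLval t 1 0 + (v ^+ 2 + v)
                  - 2%:R * (GLval t 1 0 + GLval t 1 0 * v)); last by ring.
        by rewrite tv two0 mul0r subr0 -mulr2n -mulr_natl two0 mul0r.
      move/eqP; rewrite mulf_eq0 !subr_eq0 -Ds' => /orP[] /eqP tE; [left|right].
        by apply/eqP/O2_even_inj.
      by apply/eqP/O2_even_inj.
    case=> /eqP->; first by rewrite eqxx.
    split; first exact: s'G.
    rewrite !conj_act_vb_even // Ds' -/v.
    rewrite (_ : (v + 1) ^+ 2 + _ = v ^+ 2 + v + 2%:R * (v + 1)); last by ring.
    by rewrite two0 mul0r addr0.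
  rewrite cards2 (_ : s != s') //; apply/eqP=> ss'; move: Ds'; rewrite -ss' -/v.
  by move/eqP; rewrite -subr_eq0 opprD addrA subrr add0r oppr_eq0 oner_eq0.
exact: card_undup_fibers fib.
Qed.

Lemma shear_pow k w :
  shear w ^+ (2 ^ k) = vb K ^+ (2 ^ k) + (w ^+ (2 ^ k))%:MP * (va K + vd K)
    ^+ (2 ^ k).
Proof.
rewrite /shear exprDn_pchar ?exprMn ?rmorphXn //.
by rewrite pnatX pnatE // pcharT.
Qed.

Lemma conj_act_trace s : s \in O2 K -> conj_act s (va K + vd K) = va K + vd K.
Proof. exact: (invariantsP _ (trace_invariant K)). Qed.

(** With t the trace, b^(2^k) gains (u^(2^(k+1)) - u^(2^k)) t^(2^k). After multiplication by the
    accompanying power of t every gain is a multiple of t^(2^e), and the coefficients telescope to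
    u^q - u = 0. *)
Lemma f3_even_invariant : f3_even K e \in invariants K.
Proof.
apply/invariantsP=> s sG; rewrite /f3_even rmorph_sum /=.
set t := va K + vd K; set u := s 1 0.
transitivity (\sum_(0 <= k < e.+1) (vb K ^+ (2 ^ k) * t ^+ (2 ^ e - 2 ^ k)
   + (u ^+ (2 ^ k.+1) - u ^+ (2 ^ k))%:MP * t ^+ (2 ^ e))).
  rewrite !big_mkord; apply: eq_bigr => k _.
  rewrite rmorphM !rmorphXn /= conj_act_trace // conj_act_vb_even // shear_pow.
  rewrite mulrDl -mulrA -exprD subnKC ?leq_exp2l -1?ltnS //.
  congr (_ + _%:MP * _); rewrite exprDn_pchar;
    last by rewrite pnatX pnatE // pchar2.
  by rewrite -exprM -expnS opp2.
rewrite big_split /= -[RHS]addr0; congr (_ + _).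
rewrite -big_distrl -rmorph_sum telescope_sumr //= -cardK expf_card.
by rewrite expn0 expr1 subrr mpolyC0 mul0r.
Qed.

Lemma f3_even_homog : f3_even K e \is (2 ^ e).-homog.
Proof.
rewrite /f3_even big_mkord; apply: rpred_sum => k _.
have hX (i : 'I_3) : ('X_i : T) \is 1.-homog by rewrite dhomogX /= mdeg1.
have hexp (p : T) j : p \is 1.-homog -> p ^+ j \is j.-homog.
  by move=> hp; have := dhomogMn j hp; rewrite mul1n.
have {2}<- : (2 ^ k + (2 ^ e - 2 ^ k) = 2 ^ e)%N.
  by rewrite subnKC ?leq_exp2l -1?ltnS.
by apply: dhomogM; apply: hexp; rewrite ?rpredD ?hX.
Qed.

Lemma f3_even_kill : f3_even K e \mPo kill i1 = 0.
Proof.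
rewrite /f3_even rmorph_sum /= big1 // => k _.
by rewrite rmorphM rmorphXn /= comp_killX eqxx expr0n expn_eq0 mul0r.
Qed.

(** Setting a = d = 0 leaves only the term k = e, namely b^(2^e). *)
Lemma f3_even_neq0 : f3_even K e != 0.
Proof.
apply/eqP=> /(congr1 (comp_mpoly (restr K [set i1]))).
rewrite rmorph0 /f3_even rmorph_sum /= big_nat_recr //= big_nat big1 => [|k ke].
  rewrite add0r rmorphM rmorphXn /= comp_restrX in_set1 eqxx subnn expr0
    rmorph1.
  by rewrite mulr1 => /eqP; rewrite expf_eq0 (negPf (mpolyXU_neq0 _ _)) andbF.
rewrite rmorphM [X in _ * X]rmorphXn /= rmorphD /= !comp_restrX !in_set1 /=
  addr0.
rewrite expr0n subn_eq0 leqNgt ltn_exp2l //.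
by case/andP: ke => _ ->; rewrite mulr0.
Qed.

(** The orbit product divides f_3, and both have degree 2^e = q/2, so the quotient is a nonzero
    constant. *)
Lemma f3_even_orbit : exists2 c, c != 0 & f3_even K e = c *: orbit_prod (vb K).
Proof.
have [h Dh] := orbit_prod_dvd conj_fix_vb f3_even_invariant f3_even_kill.
have h0 : h != 0 by apply: contraNneq f3_even_neq0; rewrite Dh => ->;
  rewrite mulr0.
have : msize (f3_even K e) = (2 ^ e).+1.
  have := dhomog_uniq f3_even_neq0 (dhomog_msize f3_even_homog) f3_even_homog.
  by move=> <-; rewrite prednK // lt0n msize_poly_eq0 f3_even_neq0.
rewrite Dh msizeM ?orbitX_neq0 // orbitX_msize addSn /=.
have -> : size (conj_orbit (vb K)) = (2 ^ e)%N.
  apply/eqP; rewrite -(eqn_pmul2l (isT :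
    0 < 2)%N) -card_O2_orbit_even card_O2_even.
  by rewrite cardK expnS.
rewrite -[X in _ = X]addn1 => /addnI/eqP/msize_poly1P[c c0 Dc].
by exists c => //; rewrite Dc mulrC mul_mpolyC.
Qed.

End Even.
End Fix.

(** * Invariants modulo a variable *)

Section InAlg.
Variables (K : fieldType) (n m : nat) (x : m.-tuple {mpoly K[n]}).

Lemma in_alg_tnth j : Defs.in_alg x (tnth x j).
Proof. by exists 'X_j; rewrite comp_mpolyXt. Qed.

Lemma in_alg0 : Defs.in_alg x 0.
Proof. by exists 0; rewrite comp_mpoly0. Qed.

Lemma in_algD p q : Defs.in_alg x p -> Defs.in_alg x q -> Defs.in_alg x (p + q).
Proof. by move=> [g ->] [h ->]; exists (g + h); rewrite comp_mpolyD. Qed.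

Lemma in_algN p : Defs.in_alg x p -> Defs.in_alg x (- p).
Proof. by move=> [g ->]; exists (- g); rewrite comp_mpolyN. Qed.

Lemma in_algM p q : Defs.in_alg x p -> Defs.in_alg x q -> Defs.in_alg x (p * q).
Proof. by move=> [g ->] [h ->]; exists (g * h); rewrite rmorphM. Qed.

Lemma in_algZ c p : Defs.in_alg x p -> Defs.in_alg x (c *: p).
Proof. by move=> [g ->]; exists (c *: g); rewrite comp_mpolyZ. Qed.

Lemma in_algX p k : Defs.in_alg x p -> Defs.in_alg x (p ^+ k).
Proof. by move=> [g ->]; exists (g ^+ k); rewrite rmorphXn. Qed.

Lemma in_alg_comp k (y : k.-tuple {mpoly K[n]}) (p : {mpoly K[k]}) :
  (forall j, Defs.in_alg x (tnth y j)) -> Defs.in_alg x (p \mPo y).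
Proof.
move=> xy; rewrite comp_mpolyE; elim/big_ind: _ => [|p1 p2|v _];
  first exact: in_alg0.
  exact: in_algD.
apply: in_algZ; elim/big_ind: _ => [|p1 p2|j _]; last exact: in_algX.
  by exists 1; rewrite rmorph1.
exact: in_algM.
Qed.

End InAlg.

Section Reduction.
Variable K : finFieldType.
Local Notation T := {mpoly K[3]}.
Local Notation kill i := (restr K [set~ i]).
Implicit Types (s t : {'GL_2[K]}).
Local Notation trc := (va K + vd K).
Local Notation dt := (va K * vd K - vb K ^+ 2).
Local Notation gens f3 := [tuple trc; dt; f3].

Lemma trace_msize : (msize trc <= 2)%N.
Proof. by rewrite (leq_trans (msizeD_le _ _)) // !msizeX !mdeg1. Qed.

Lemma det_msize : (msize dt <= 3)%N.
Proof.
rewrite (leq_trans (msizeD_le _ _)) // msizeN geq_max.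
rewrite (@msizeM_leq _ _ _ _ 1 1) ?msizeX ?mdeg1 //=.
by rewrite (@msizeX_leq _ _ _ 1 2) ?msizeX ?mdeg1.
Qed.

Lemma big_ord3 (R : Type) (idx : R) (op : Monoid.law idx) (F : 'I_3 -> R) :
  \big[op/idx]_(i < 3) F i = op (op (F i0) (F i1)) (F i2).
Proof.
rewrite 3!big_ord_recl big_ord0 Monoid.mulm1 Monoid.mulmA.
by congr (op (op (F _) (F _)) (F _)); apply: val_inj.
Qed.

Lemma ord3_ind (P : 'I_3 -> Prop) : P i0 -> P i1 -> P i2 -> forall i, P i.
Proof.
move=> P0 P1 P2 [[|[|[|i]]] h]; last by [].
- by rewrite (_ : Ordinal h = i0) //; apply: val_inj.
- by rewrite (_ : Ordinal h = i1) //; apply: val_inj.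
- by rewrite (_ : Ordinal h = i2) //; apply: val_inj.
Qed.

Lemma killed_monomial i (m : 'X_{1..3}) :
  'X_[m] \mPo kill i = if m i == 0%N then 'X_[m] else 0 :> T.
Proof.
rewrite comp_mpolyX [in RHS]mpolyXE_id; case: eqP => [mi|/eqP mi].
  apply: eq_bigr => j _; rewrite -comp_mpolyXt comp_killX.
  by case: eqP => // ->; rewrite mi !expr0.
rewrite (bigD1 i) //= -comp_mpolyXt comp_killX eqxx expr0n (negPf mi).
by rewrite mul0r.
Qed.

(** * Reduction modulo a *)

Section Odd.
Hypothesis two_neq0 : 2%:R != 0 :> K.

(** The matrix diag(1, -1) fixes a and d and negates b, so a coefficient at an odd power of b equals
    its own negative. *)
Lemma invariant_even_vb (p : T) m :
  p \in invariants K -> m \in msupp p -> ~~ odd (m i1).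
Proof.
move/invariantsP=> pG mp; apply/negP=> om.
have [|||s sG [s1 s2 s3 s4]] := @O2_exists K 1 0 0 (-1).
- by rewrite expr1n expr0n addr0.
- by rewrite sqrrN expr1n expr0n add0r.
- by rewrite mulr0 mul0r addr0.
have E : forall v : 'X_{1..3}, conj_act s 'X_[v] = (-1) ^+ v i1 *: 'X_[v] :> T.
  move=> v; rewrite [in LHS]mpolyXE_id rmorph_prod /= mpolyXE_id !big_ord3.
  rewrite !rmorphXn /= conj_actX0 // conj_actX1 // conj_actX2 // s1 s2 s3 s4.
  rewrite /quad !(mulr0, mul0r, mulr1, mul1r, addr0, add0r, rmorph0, rmorph1).
  rewrite mulrNN mulr1 rmorph1 mul1r rmorphN rmorph1 mulN1r.
  by rewrite -[- vb K]scaleN1r exprZn -scalerAr -scalerAl.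
have := pG s sG; rewrite {1}[p]mpolyE rmorph_sum /=.
move/(congr1 (mcoeff m)); rewrite raddf_sum /= (bigD1_seq m) ?msupp_uniq //=.
rewrite conj_actZ E !mcoeffZ mcoeffX eqxx mulr1 big1 => [|v vm]; last first.
  by rewrite conj_actZ E !mcoeffZ mcoeffX (negPf vm) !mulr0.
rewrite -signr_odd om expr1 addr0 mulrN1 => /eqP; rewrite eq_sym.
by apply/negP/neq_opp; rewrite // -mcoeff_msupp.
Qed.

(** Modulo a, the trace is d and -det is b^2. Since [p] is even in b, each monomial b^(2j) d^k lifts
    to (-det)^j trace^k, of the same degree. *)
Lemma odd_reduction (f3 p : T) : p \in invariants K -> exists r,
  [/\ Defs.in_alg (gens f3) r, (msize r <= msize p)%N & (p - r) \mPo kill i0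
    = 0].
Proof.
move=> pG.
exists (\sum_(m <- msupp p | m i0 == 0%N)
  p@_m *: ((- dt) ^+ (m i1)./2 * trc ^+ m i2)); split.
- elim/big_ind: _ => [|p1 p2|m _]; [exact: in_alg0 | exact: in_algD |].
  apply/in_algZ/in_algM; apply: in_algX; last exact: (in_alg_tnth (gens f3) i0).
  apply: in_algN; exact: (in_alg_tnth (gens f3) i1).
- apply: msize_sum_leq => m mp _; rewrite (leq_trans (msizeZ_le _ _)) //.
  apply: leq_trans (msize_mdeg_lt mp).
  have h1 : (msize ((- dt) ^+ (m i1)./2) <= (2 * (m i1)./2).+1)%N.
    by apply: msizeX_leq; rewrite msizeN det_msize.
  have h2 : (msize (trc ^+ m i2) <= (1 * m i2).+1)%N.
    by apply: msizeX_leq; exact: trace_msize.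
  rewrite (leq_trans (msizeM_leq h1 h2)) // ltnS mul1n mdegE big_ord3 /=.
  rewrite leq_add2r mul2n (leq_trans _ (leq_addl _ _)) //.
  by rewrite -{2}[m i1]odd_double_half leq_addl.
apply/eqP; rewrite comp_mpolyB subr_eq0 /= {1}[p]mpolyE !rmorph_sum /=.
apply/eqP; rewrite [RHS]big_mkcond /= big_seq [RHS]big_seq.
apply: eq_bigr => m mp; rewrite comp_mpolyZ killed_monomial.
case: eqP => m0; last by rewrite scaler0.
rewrite comp_mpolyZ; congr (_ *: _);
  rewrite rmorphM !rmorphXn rmorphN rmorphB /=.
rewrite rmorphM rmorphXn rmorphD /= !comp_killX /= mul0r !add0r opprK.
rewrite -exprM mul2n mpolyXE_id big_ord3 /= m0 expr0 mul1r.
by rewrite -{1}[m i1]odd_double_half (negPf (invariant_even_vb pG mp)).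
Qed.

End Odd.

(** * Polynomials symmetric in a and d, modulo b *)

Section Even.

Local Notation sw := [tuple vd K; vb K; va K].

Lemma trace_sw : trc \mPo sw = trc.
Proof. by rewrite comp_mpolyD /va /vd !comp_mpolyXU addrC. Qed.

Lemma swap_kill (p : T) : (p \mPo kill i1) \mPo sw = (p \mPo sw) \mPo kill i1.
Proof.
transitivity (p \mPo [tuple vd K; 0; va K]).
  apply: comp_mpoly_eq; apply: ord3_ind;
    rewrite -comp_mpolyXt [RHS](tnth_nth 0) /=.
  - by rewrite comp_killX /= comp_mpolyXU.
  - by rewrite comp_killX /= comp_mpoly0.
  - by rewrite comp_killX /= comp_mpolyXU.
symmetry; apply: comp_mpoly_eq; apply: ord3_ind; rewrite !(tnth_nth 0) /=.
- by rewrite comp_killX.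
- by rewrite comp_killX.
by rewrite comp_killX.
Qed.

(** Modulo b the generators become a + d and ad, and the argument is that for symmetric polynomials:
    subtract p(trace, 0, 0), divide by ad, and recurse. Only symmetry under the swap is assumed, as
    this is what the quotient inherits. *)
Lemma even_reduction (f3 p : T) : p \mPo sw = p -> exists r,
  [/\ Defs.in_alg (gens f3) r, (msize r <= msize p)%N & (p - r) \mPo kill i1
    = 0].
Proof.
have [k] := ubnP (msize p); elim: k p => // k IHk p; rewrite ltnS => pk psw.
set s := p \mPo [tuple trc; 0; 0].
have s_alg : Defs.in_alg (gens f3) s.
  apply: in_alg_comp; apply: ord3_ind; rewrite (tnth_nth 0) /=.
  - exact: (in_alg_tnth (gens f3) i0).
  - exact: in_alg0.
  - exact: in_alg0.
have s_size : (msize s <= msize p)%N.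
  apply: msize_comp_leq; apply: ord3_ind; rewrite (tnth_nth 0) /= ?msize0 //.
  exact: trace_msize.
have s_sw : s \mPo sw = s.
  apply: comp_mpoly_eq; apply: ord3_ind; rewrite (tnth_nth 0) /=.
  - exact: trace_sw.
  - exact: comp_mpoly0.
  exact: comp_mpoly0.
pose q := (p - s) \mPo kill i1.
have q_sw : q \mPo sw = q by rewrite /q swap_kill comp_mpolyB psw s_sw.
have q_kill1 : q \mPo kill i1 = q by rewrite /q comp_restrI setIid.
(* At b = d = 0 both p and p(trace, 0, 0) become p(a, 0, 0). *)
have q_kill2 : q \mPo kill i2 = 0.
  rewrite /q !comp_mpolyB; apply/eqP; rewrite subr_eq0; apply/eqP.
  transitivity (p \mPo [tuple va K; 0; 0]).
    rewrite comp_restrI; congr (_ \mPo _); apply: eq_from_tnth; apply: ord3_ind;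
    by rewrite tnth_mktuple !inE [RHS](tnth_nth 0).
  rewrite comp_restrI; symmetry; apply: comp_mpoly_eq.
  apply: ord3_ind; rewrite (tnth_nth 0) [RHS](tnth_nth 0) /=.
  - by rewrite comp_mpolyD !comp_restrX !inE /= addr0.
  - exact: comp_mpoly0.
  exact: comp_mpoly0.
have q_size : (msize q <= msize p)%N.
  apply: leq_trans (_ : msize (p - s) <= _)%N.
    apply: msize_comp_leq => j; rewrite tnth_mktuple.
    by case: ifP; rewrite ?msize0 ?msizeX ?mdeg1.
  by rewrite (leq_trans (msizeD_le _ _)) // msizeN geq_max leqnn.
have [q1 Dq1] := kill_eq0 q_kill2.
(* Being symmetric and divisible by d, [q] is divisible by a as well. *)
have [q2 Dq2] : exists q2, q = va K * vd K * q2.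
  have : q \mPo kill i0 = 0.
    rewrite -q_sw Dq1 rmorphM rmorphM /= comp_mpolyXU /= comp_killX eqxx.
    by rewrite mul0r.
  rewrite Dq1 rmorphM /= comp_killX /= => /eqP.
  rewrite mulf_eq0 (negPf (mpolyXU_neq0 _ _)) => /eqP/kill_eq0[q2 ->].
  by exists q2; rewrite mulrA [_ * 'X_i0]mulrC.
have nzad : va K * vd K != 0 by rewrite mulf_neq0 ?mpolyXU_neq0.
have q2_sw : q2 \mPo sw = q2.
  apply: (mulfI nzad); rewrite -Dq2 -[RHS]q_sw Dq2 !rmorphM /= /va /vd
    !comp_mpolyXU /=.
  by rewrite [va K * _]mulrC.
have ps_kill r : r \mPo kill i1 = q -> (p - (s + r)) \mPo kill i1 = 0.
  by move=> rq; rewrite opprD addrA comp_mpolyB rq subrr.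
have [q20|q2_neq0] := eqVneq q2 0.
  exists s; split; [exact: s_alg | exact: s_size |].
  by have := ps_kill 0; rewrite addr0; apply; rewrite comp_mpoly0 Dq2 q20 mulr0.
have q2_size : ((msize q2).+2 <= msize p)%N.
  apply: leq_trans q_size; rewrite Dq2 msizeM // msizeM ?mpolyXU_neq0 //.
  by rewrite !msizeX !mdeg1 addSn.
have [|r2 [r2_alg r2_size r2_kill]] := IHk q2 _ q2_sw.
  by apply: leq_trans pk; apply: ltnW.
exists (s + dt * r2); split.
- apply: in_algD => //; apply: in_algM => //.
  exact: (in_alg_tnth (gens f3) i1).
- rewrite (leq_trans (msizeD_le _ _)) // geq_max s_size /=.
  (* For r2 = 0 the size is 0 rather than a degree plus one, hence the separate case. *)
  apply: leq_trans q2_size; case Er: (msize r2) r2_size => [|j] r2_size.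
    by move/eqP: Er; rewrite msize_poly_eq0 => /eqP->; rewrite mulr0 msize0.
  apply: leq_trans (msizeM_leq det_msize (_ : msize r2 <= j.+1)%N) _.
    by rewrite Er.
  by rewrite !addSn add0n !ltnS.
apply: ps_kill; rewrite -[RHS]q_kill1 Dq2 !rmorphM rmorphB rmorphM rmorphXn /=.
rewrite !comp_killX /= expr0n subr0; congr (_ * _).
by apply/eqP; rewrite eq_sym -subr_eq0 -comp_mpolyB r2_kill.
Qed.

End Even.
End Reduction.

(** * Independence of the three generators, and the conclusion *)

Section Final.
Variable K : finFieldType.
Local Notation T := {mpoly K[3]}.
Local Notation kill i := (restr K [set~ i]).
Local Notation trc := (va K + vd K).
Local Notation dt := (va K * vd K - vb K ^+ 2).
Local Notation gens f3 := [tuple trc; dt; f3].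

(** Three uses of [indep_step]: the successive killings make the third, the second and finally the
    first entry vanish. *)
Lemma alg_indep3 (x y z : 3.-tuple T) (j1 j2 j3 : 'I_3) :
  tnth x i2 != 0 -> (forall k, tnth x k \mPo kill j1 = tnth y k) ->
  tnth y i2 = 0 -> tnth y i1 != 0 ->
  (forall k, tnth y k \mPo kill j2 = tnth z k) ->
  tnth z i1 = 0 -> tnth z i2 = 0 -> tnth z i0 != 0 ->
  tnth z i0 \mPo kill j3 = 0 -> alg_indep x.
Proof.
move=> x2 xy y2 y1 yz z1 z2 z0 zk g gx0.
have <- : g \mPo restr K [set: 'I_3] = g.
  rewrite -[RHS]comp_mpoly_id; congr (_ \mPo _).
  by apply: eq_mktuple => i; rewrite in_setT.
apply: (indep_step (i := j1) (j := i2) (y := y) _ _ x2 xy) gx0.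
- by rewrite in_setT.
- by move=> k; rewrite in_setT.
apply: (indep_step (i := j2) (j := i1) (y := z) _ _ y1 yz).
- by rewrite !inE.
- by apply: ord3_ind; rewrite ?inE.
(* Here all entries become 0; evaluation at the zero tuple is the restriction to the empty set of
   variables, so the last condition is immediate. *)
apply: (indep_step (i := j3) (j := i0) (y := [tuple 0 | k < 3]) _ _ z0).
- by rewrite !inE.
- by apply: ord3_ind; rewrite ?inE.
- by apply: ord3_ind; rewrite tnth_mktuple ?zk // ?z1 ?z2 rmorph0.
move=> h h0; rewrite -[RHS]h0; congr (_ \mPo _).
by apply: eq_mktuple; apply: ord3_ind; rewrite !inE.
Qed.

Lemma orbitX_kill (i : 'I_3) : orbit_prod ('X_i : T) \mPo kill i = 0.
Proof.
rewrite /orbit_prod -/(conj_orbit _) rmorph_prod /=; apply/eqP.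
rewrite prodf_seq_eq0; apply/hasP; exists 'X_i;
  last by rewrite /= comp_killX eqxx.
by apply/conj_orbitP; exists 1%g; rewrite ?O2_1 ?conj_act1.
Qed.

(** The variables are killed in the order a, b, d. *)
Lemma alg_indep_odd f3 : f3 != 0 -> f3 \mPo kill i0 = 0 -> alg_indep (gens f3).
Proof.
move=> f30 f3k.
apply: (@alg_indep3 _ [tuple vd K; - vb K ^+ 2; 0] [tuple vd K; 0; 0] i0 i1 i2).
- by rewrite (tnth_nth 0).
- apply: ord3_ind; rewrite (tnth_nth 0) [RHS](tnth_nth 0) /=.
  + by rewrite comp_mpolyD !comp_killX /= add0r.
  + by rewrite comp_mpolyB rmorphM rmorphXn /= !comp_killX /= mul0r add0r.
  exact: f3k.
- by rewrite (tnth_nth 0).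
- by rewrite (tnth_nth 0) /= oppr_eq0 expf_neq0 // mpolyXU_neq0.
- apply: ord3_ind; rewrite (tnth_nth 0) [RHS](tnth_nth 0) /=.
  + by rewrite comp_killX.
  + by rewrite comp_mpolyN rmorphXn /= comp_killX /= expr0n oppr0.
  exact: comp_mpoly0.
- by rewrite (tnth_nth 0).
- by rewrite (tnth_nth 0).
- by rewrite (tnth_nth 0) /= mpolyXU_neq0.
by rewrite (tnth_nth 0) /= comp_killX.
Qed.

(** The variables are killed in the order b, d, a. *)
Lemma alg_indep_even f3 : f3 != 0 -> f3 \mPo kill i1 = 0 -> alg_indep (gens f3).
Proof.
move=> f30 f3k.
apply: (@alg_indep3 _ [tuple trc; va K * vd K; 0] [tuple va K; 0; 0] i1 i2 i0).
- by rewrite (tnth_nth 0).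
- apply: ord3_ind; rewrite (tnth_nth 0) [RHS](tnth_nth 0) /=.
  + by rewrite comp_mpolyD !comp_killX.
  + by rewrite comp_mpolyB rmorphM rmorphXn /= !comp_killX /= expr0n subr0.
  exact: f3k.
- by rewrite (tnth_nth 0).
- by rewrite (tnth_nth 0) /= mulf_neq0 ?mpolyXU_neq0.
- apply: ord3_ind; rewrite (tnth_nth 0) [RHS](tnth_nth 0) /=.
  + by rewrite comp_mpolyD !comp_killX /= addr0.
  + by rewrite rmorphM /= !comp_killX /= mulr0.
  exact: comp_mpoly0.
- by rewrite (tnth_nth 0).
- by rewrite (tnth_nth 0).
- by rewrite (tnth_nth 0) /= mpolyXU_neq0.
by rewrite (tnth_nth 0) /= comp_killX.
Qed.

Lemma a_invariant_gens f3 N : (0 < N)%N -> f3 \is N.-homog ->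
  is_polynomial_ring_on (invariants K) (gens f3) ->
  is_a_invariant (invariants K) (- (3 + N)%N%:Z).
Proof.
move=> N0 f3N pol.
have h1 (i : 'I_3) : ('X_i : T) \is 1.-homog by rewrite dhomogX /= mdeg1.
have := @polynomial_ring_a_invariant K 3 _ 3 _ (tnth [tuple 1; 2; N])%N pol.
rewrite big_ord3 !(tnth_nth 0%N) /=; apply; apply: ord3_ind;
  rewrite ?(tnth_nth 0) ?(tnth_nth 0%N) //=.
- by rewrite rpredD ?h1.
- by rewrite rpredB // ?(dhomogM (h1 _) (h1 _)) ?(dhomogMn 2 (h1 _)).
Qed.

Lemma mpdeg_homog (p : T) N : p != 0 -> p \is N.-homog -> mpdeg p = N.
Proof. by move=> p0 pN; apply: dhomog_uniq p0 (dhomog_msize pN) pN. Qed.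

Lemma conj_act_swap : exists2 s : {'GL_2[K]}, s \in O2 K &
  forall p, conj_act s p = p \mPo [tuple vd K; vb K; va K].
Proof.
have [|||s sG [s1 s2 s3 s4]] := @O2_exists K 0 1 1 0.
- by rewrite expr1n expr0n add0r.
- by rewrite expr1n expr0n addr0.
- by rewrite mul0r mulr0 addr0.
exists s => // p; rewrite /conj_act; congr (_ \mPo _).
apply: eq_from_tnth; apply: ord3_ind; rewrite (tnth_nth 0) [RHS](tnth_nth 0) /=;
  rewrite conjME // ?s1 ?s2 ?s3 ?s4 /quad;
  by rewrite !(mulr0, mul0r, addr0, add0r, mulr1, rmorph0, rmorph1, mul1r).
Qed.

End Final.

Theorem theorem10p2 (K : finFieldType) :
  (odd #|K| ->
     let f3 := orbit_prod (va K) in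
     [/\ is_polynomial_ring_on (invariants K)
           [tuple va K + vd K; va K * vd K - vb K ^+ 2; f3],
         (mpdeg f3)%:R = #|O2 K|%:R / 4%:R :> rat
       & exists z : int,
           is_a_invariant (invariants K) z /\
           z%:~R = - (3%:R + 2%:R^-1 *
                     (#|K|%:R - (-1) ^+ ((#|K| - 1) %/ 2))) :> rat])
  /\
  (forall e : nat, #|K| = (2 ^ e.+1)%N ->
     let f3 := f3_even K e in
     [/\ is_polynomial_ring_on (invariants K)
           [tuple va K + vd K; va K * vd K - vb K ^+ 2; f3],
         (mpdeg f3)%:R = #|O2 K|%:R / 2%:R :> rat,
         #|O2 K|%:R / 2%:R = #|K|%:R / 2%:R :> rat
       & exists z : int,
           is_a_invariant (invariants K) z /\
           z%:~R = - (3%:R + #|K|%:R / 2%:R) :> rat]).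
Proof.
split=> [oddK | e cardK] f3.
  have two_neq0 := odd_two_neq0 oddK.
  have f3_neq0 : f3 != 0 := orbitX_neq0 _ _.
  have f3_homog := orbitX_homog K (@Ordinal 3 0 isT).
  set N := size _ in f3_homog.
  have N_gt0 : (0 < N)%N := orbitX_gt0 _ _.
  have pol : is_polynomial_ring_on (invariants K)
      [tuple va K + vd K; va K * vd K - vb K ^+ 2; f3].
    split; last exact: alg_indep_odd f3_neq0 (orbitX_kill _ _).
    move=> p; apply: (invariants_generated (@conj_fix_va K) (oner_neq0 K)).
      by rewrite scale1r.
    by move=> q; apply: odd_reduction.
  have cardC : #|circle K| = (2 * N)%N := card_circle_orbit two_neq0.
  have cardG : #|O2 K| = (4 * N)%N by rewrite card_O2_circle // cardC mulnA.
  split=> //.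
    by rewrite (mpdeg_homog f3_neq0 f3_homog) cardG natrM; field.
  exists (- (3 + N)%N%:Z); split;
    first exact: (a_invariant_gens N_gt0 f3_homog pol).
  have q_gt1 := finNzRing_gt1 K.
  (* Both sides count the circle: it has 2N points, by the orbit of a, and q + 1 or q - 1 points
     according to the parity of (q-1)/2. *)
  have -> : #|K|%:R - (-1) ^+ ((#|K| - 1) %/ 2) = 2%:R * N%:R :> rat.
    rewrite -natrM -cardC card_circle // -signr_odd.
    case: (odd _); first by rewrite expr1 opprK natr1.
    by rewrite -[in LHS](ltn_predK q_gt1) -natr1 addrK.
  by rewrite mulrA mulVf // mul1r rmorphN /= -pmulrn natrD.
have two0 : 2%:R = 0 :> K.
  by have := card_finPcharP cardK isT; rewrite inE => /andP[_ /eqP].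
have f3_neq0 : f3 != 0 := f3_even_neq0 K e.
have f3_homog : f3 \is (2 ^ e).-homog := f3_even_homog K e.
have [c c0 Df3] := f3_even_orbit two0 cardK.
have pol : is_polynomial_ring_on (invariants K)
    [tuple va K + vd K; va K * vd K - vb K ^+ 2; f3].
  split; last exact: alg_indep_even f3_neq0 (f3_even_kill K e).
  move=> p; apply: (invariants_generated (conj_fix_vb two0) c0 Df3).
  (* The swap of a and d is conjugation by the orthogonal permutation matrix. *)
  move=> q qG; apply: even_reduction; have [s sG <-] := conj_act_swap K.
  exact: (invariantsP _ qG).
have cardG := card_O2_even two0.
split=> //.
- by rewrite (mpdeg_homog f3_neq0 f3_homog) cardG cardK expnSr natrM mulfK.
- by rewrite cardG.
exists (- (3 + 2 ^ e)%N%:Z); split.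
  have e_gt0 : (0 < 2 ^ e)%N by rewrite expn_gt0.
  exact: (a_invariant_gens e_gt0 f3_homog pol).
by rewrite cardK expnSr natrM mulfK // rmorphN /= -pmulrn natrD.
Qed.
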